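(* Consider the geometric model of the Lorenz equations, the map $f$, its invariant measure $\mu_f$ and the origin map $O$ described in the context. There is a constant $h_{\max}>0$ such that for every $0<h\le h_{\max}$, with $t_i=ih$, for $\mu_f$-almost every $x\in[-1/2,1/2]$ and every $u\in\Lambda^{\mathrm{geo}}$ with $O_1(u)=x$, there exist, for every $k\in\mathbb N$, continuous curves $\tilde U(u,k)\subset\Lambda^{\mathrm{geo}}$ and constants $\tilde d_{\max}(u,k)\ge0$, $C_{\tilde U}(u,k)<\infty$, an infinite sequence of indices $i_1(u),i_2(u),\ldots$, and constants $\tilde d_{\max}(u)>0$, $C_{\tilde U}(u)<\infty$ with the properties (i) $\{\|v(t_k)-u(t_k)\|_\infty: v\in\tilde U(u,k)\}=[0,\tilde d_{\max}(u,k)]$, (ii) $\sum_{i=0}^k\|v(t_i)-u(t_i)\|_\infty\le C_{\tilde U}(u,k)\|v(t_k)-u(t_k)\|_\infty$ for all $v\in\tilde U(u,k)$, (iii) $C_{\tilde U}(u,i_j(u))\le C_{\tilde U}(u)$ and $\tilde d_{\max}(u,i_j(u))\ge\tilde d_{\max}(u)$ for all $j\ge1$, and for these the following holds. Suppose the model started at $u$ is observed at the times $t_i$, $i=0,1,\ldots$, with observation matrix $H\in\mathbb R^{d_o\times3}$ and observation errors uniform on $[-\epsilon,\epsilon]^{d_o}$, and the prior $q$ satisfies $q(v)>0$ for every $v\in\Lambda^{\mathrm{geo}}$. Then for every $j\ge1$ and every $0<\epsilon\le d_oC_{\tilde U}(u)\tilde d_{\max}(u)\|H\|_\infty$, the expected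 diameter of the support of the filter after observations up to time $t_{i_j(u)}$ is larger than or equal to $$\frac{\epsilon}{2d_oC_{\tilde U}(u)\|H\|_\infty}.$$
   Context: Geometric model. Parameters: $0<\lambda_3<\lambda_1<\lambda_2$ and $\theta$; put $\alpha=\lambda_3/\lambda_1$, $\beta=\lambda_2/\lambda_1$ and assume $\frac1{\sqrt2}<\alpha<1$, $\beta>\frac{\log 6}{\log 2}-1$, $\frac{2^\alpha}{\sqrt2\,\alpha}<\theta<2^\alpha$. Let $S=\{(u_1,u_2,1):|u_1|\le\frac12,|u_2|\le\frac12\}$, $S^*=\{u\in S:u_1\ne0\}$, $\Gamma=\{u\in S:u_1=0\}$. Linear phase: a path started at $u\in S$ follows $\Psi^{\mathrm{lin}}_t(u)=(u_1e^{\lambda_1t},u_2e^{-\lambda_2t},u_3e^{-\lambda_3t})$ until it reaches $\Sigma=\{|u_1|=1\}$. For $u\in S^*$ this happens at time $\tau_\Sigma(u)=\frac1{\lambda_1}\log(1/|u_1|)$ at the point $(\mathrm{sgn}(u_1),u_2|u_1|^\beta,|u_1|^\alpha)$; paths started on $\Gamma$ follow the linear flow forever and converge to the origin. Rotation phase: from the point $w=(\pm1,w_2,w_3)$ reached on $\Sigma$, with $r(s)=1-w_3+\left(\frac12-(\theta-1)w_3\right)\frac{s}{(3/2)\pi}$, the path for $0\le s\le\frac32\pi$ is $\Psi^{\mathrm{rot}}_s(w)=\left(1+r(s)\sin s,\ w_2-\frac14\frac{s}{(3/2)\pi},\ 1-r(s)\cos s\right)$ if $w_1=1$, and $\Psi^{\mathrm{rot}}_s(w)=\left(-1-r(s)\sin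 s,\ w_2+\frac14\frac{s}{(3/2)\pi},\ 1-r(s)\cos s\right)$ if $w_1=-1$. At $s=\frac32\pi$ the path is back in $S$ and the linear phase starts again. $\Lambda^{\mathrm{geo}}\subset\mathbb R^3$ is the union of all points on paths started in $S$ until their first return to $S$ (including the points on the non-returning paths started on $\Gamma$). $\Psi^{\mathrm{geo}}_t$ is the semigroup on $\Lambda^{\mathrm{geo}}$ obtained by concatenating the two phases, and $u(t):=\Psi^{\mathrm{geo}}_t(u)$, $v(t):=\Psi^{\mathrm{geo}}_t(v)$. Origin: for $v\in\Lambda^{\mathrm{geo}}$, $O(v)=(O_1(v),O_2(v),O_3(v))\in S$ is the unique point of $S$ such that the path started from $O(v)$ passes through $v$ before returning to $S$. The map $f:[-\frac12,\frac12]\setminus\{0\}\to[-\frac12,\frac12]$ is $f(x)=\theta|x|^\alpha-\frac12$ for $x>0$, $f(x)=-\theta|x|^\alpha+\frac12$ for $x<0$. It is a known fact that $f$ has a unique invariant probability measure $\mu_f$ on $[-\frac12,\frac12]$ absolutely continuous with respect to Lebesgue measure; it is ergodic and its density is bounded. Observations: $Y_i=Hu(t_i)+Z_i$ with $Z_i$ i.i.d. uniform on $[-\epsilon,\epsilon]^{d_o}$. The prior $q$ is a probability density on $\Lambda^{\mathrm{geo}}$ for the initial position. The filter at time $t_k$ is the conditional distribution of the position at time $t_k$ given $Y_0,\ldots,Y_k$; its support (the set where its density is nonzero) is the set of $v(t_k)$ with $v\in\Lambda^{\mathrm{geo}}$, $q(v)>0$ and $\|Y_i-Hv(t_i)\|_\infty\le\epsilon$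 for $0\le i\le k$. The expectation is over the noise, for the fixed true initial point $u$. $\|H\|_\infty$ is the operator norm induced by $\|\cdot\|_\infty$. *)

(* Defs.v *)
From HB Require Import structures.
From mathcomp Require Import all_boot all_order all_algebra.
From mathcomp Require Import all_classical all_reals all_analysis.

Set Implicit Arguments.
Unset Strict Implicit.
Unset Printing Implicit Defensive.

Import Order.TTheory GRing.Theory Num.Theory.
Import numFieldNormedType.Exports.

Local Open Scope classical_set_scope.
Local Open Scope ring_scope.

(* Points of R^3 are column vectors; the norm `|u| of a matrix type in
   MathComp-Analysis is the maximum norm, so `|v - u| is the distance in the
   sup norm. *)

Definition vec3 (R : realType) (a b c : R) : 'cV[R]_3 :=
  \col_(i < 3) [:: a; b; c]`_i.

Record lorenz_params (R : realType) := LorenzParams {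
  lam1 : R; lam2 : R; lam3 : R; theta : R }.

Definition alpha (R : realType) (p : lorenz_params R) : R := lam3 p / lam1 p.
Definition beta (R : realType) (p : lorenz_params R) : R := lam2 p / lam1 p.

Definition admissible (R : realType) (p : lorenz_params R) : Prop :=
  [/\ [/\ 0 < lam3 p, lam3 p < lam1 p & lam1 p < lam2 p],
      (Num.sqrt 2)^-1 < alpha p < 1,
      ln 6 / ln 2 - 1 < beta p
    & 2 `^ (alpha p) / (Num.sqrt 2 * alpha p) < theta p < 2 `^ (alpha p)].

Definition section_S (R : realType) : set 'cV[R]_3 :=
  [set u | [/\ `|u 0 0| <= 1 / 2, `|u 1 0| <= 1 / 2 & u 2 0 = 1]].

Definition Psi_lin (R : realType) (p : lorenz_params R) (t : R) (u : 'cV[R]_3)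
    : 'cV[R]_3 :=
  vec3 (u 0 0 * expR (lam1 p * t))
       (u 1 0 * expR (- lam2 p * t))
       (u 2 0 * expR (- lam3 p * t)).

Definition tau_Sigma (R : realType) (p : lorenz_params R) (u : 'cV[R]_3) : R :=
  1 / lam1 p * ln (1 / `|u 0 0|).

Definition exit_point (R : realType) (p : lorenz_params R) (u : 'cV[R]_3)
    : 'cV[R]_3 :=
  vec3 (Num.sg (u 0 0)) (u 1 0 * `|u 0 0| `^ beta p) (`|u 0 0| `^ alpha p).

Definition rot_time (R : realType) : R := 3 / 2 * pi.

Definition rot_radius (R : realType) (p : lorenz_params R) (w : 'cV[R]_3)
    (s : R) : R :=
  1 - w 2 0 + (1 / 2 - (theta p - 1) * w 2 0) * (s / rot_time R).

(* Only used for w 0 0 = 1 or w 0 0 = -1. *)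
Definition Psi_rot (R : realType) (p : lorenz_params R) (s : R) (w : 'cV[R]_3)
    : 'cV[R]_3 :=
  let r := rot_radius p w s in
  if w 0 0 == 1 then
    vec3 (1 + r * sin s) (w 1 0 - 1 / 4 * (s / rot_time R)) (1 - r * cos s)
  else
    vec3 (-1 - r * sin s) (w 1 0 + 1 / 4 * (s / rot_time R)) (1 - r * cos s).

(* [excursion p u t] is the position at time t of the path started at u in S,
   for the times t satisfying [before_return p u t], i.e. from time 0
   (included) to the first return to S (excluded); paths started on
   Gamma = {u_1 = 0} never return. *)
Definition before_return (R : realType) (p : lorenz_params R) (u : 'cV[R]_3)
    (t : R) : bool :=
  (0 <= t) && ((u 0 0 == 0) || (t < tau_Sigma p u + rot_time R)).

Definition excursion (R : realType) (p : lorenz_params R) (u : 'cV[R]_3)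
    (t : R) : 'cV[R]_3 :=
  if (u 0 0 == 0) || (t <= tau_Sigma p u) then Psi_lin p t u
  else Psi_rot p (t - tau_Sigma p u) (exit_point p u).

Definition first_return (R : realType) (p : lorenz_params R) (u : 'cV[R]_3)
    : 'cV[R]_3 :=
  Psi_rot p (rot_time R) (exit_point p u).

(* Concatenation of successive excursions. [n] bounds the number of returns to
   S; since every excursion lasts longer than 3/2 pi > 1, at most
   [Num.truncn t] of them are completed by time t. *)
Fixpoint flow_from_S_rec (R : realType) (p : lorenz_params R) (n : nat)
    (u : 'cV[R]_3) (t : R) : 'cV[R]_3 :=
  if before_return p u t then excursion p u t
  else if n is n'.+1 then
    flow_from_S_rec p n' (first_return p u) (t - (tau_Sigma p u + rot_time R))
  else u.

Definition flow_from_S (R : realType) (p : lorenz_params R)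
    (u : 'cV[R]_3) (t : R) : 'cV[R]_3 :=
  flow_from_S_rec p (Num.truncn t) u t.

(* The return point itself belongs to S, so it is the time-0 point of another
   path and nothing is lost by using the half-open excursions. *)
Definition Lambda_geo (R : realType) (p : lorenz_params R) : set 'cV[R]_3 :=
  [set v | exists u t,
    [/\ section_S u, before_return p u t & excursion p u t = v]].

Definition origin (R : realType) (p : lorenz_params R) (v : 'cV[R]_3)
    : 'cV[R]_3 :=
  xget 0 [set u | section_S u /\
    exists2 t, before_return p u t & excursion p u t = v].

(* The time at which the path started at [origin p v] passes through v. *)
Definition age (R : realType) (p : lorenz_params R) (v : 'cV[R]_3) : R :=
  xget 0 [set t | before_return p (origin p v) t /\
                  excursion p (origin p v) t = v].

(* The semigroup on Lambda_geo. *)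
Definition Psi_geo (R : realType) (p : lorenz_params R) (t : R) (v : 'cV[R]_3)
    : 'cV[R]_3 :=
  flow_from_S p (origin p v) (age p v + t).

(* Meant on [-1/2, 1/2] \ {0}; the value at 0 is immaterial because the
   invariant measure is absolutely continuous. *)
Definition fmap_geo (R : realType) (p : lorenz_params R) (x : R) : R :=
  if 0 < x then theta p * `|x| `^ alpha p - 1 / 2
  else - (theta p * `|x| `^ alpha p) + 1 / 2.

(* Absolutely continuous invariant probability measures of f on
   [-1/2, 1/2], seen as measures on R carried by that interval. *)
Definition is_acip (R : realType) (p : lorenz_params R)
    (mu : probability (measurableTypeR R) R) : Prop :=
  [/\ mu `[- (1 / 2), 1 / 2]%classic = 1%E,
      (forall A, measurable A -> mu (fmap_geo p @^-1` A) = mu A)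
    & mu `<< lebesgue_measure].

Definition is_ergodic (R : realType) (p : lorenz_params R)
    (mu : probability (measurableTypeR R) R) : Prop :=
  forall A, measurable A ->
    `[- (1 / 2), 1 / 2] `&` fmap_geo p @^-1` A = `[- (1 / 2), 1 / 2] `&` A ->
    mu A = 0%E \/ mu A = 1%E.

Definition has_bounded_density (R : realType)
    (mu : probability (measurableTypeR R) R) : Prop :=
  exists (g : measurableTypeR R -> R) (M : R),
    [/\ measurable_fun [set: measurableTypeR R] g,
        (forall x, 0 <= g x <= M)
      & (forall A, measurable A ->
           mu A = \int[lebesgue_measure]_(x in A) (g x)%:E)%E].

(* [mu] is the measure mu_f, with the properties of it that are known. *)
Definition is_mu_f (R : realType) (p : lorenz_params R)
    (mu : probability (measurableTypeR R) R) : Prop :=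
  [/\ is_acip p mu,
      (forall nu : probability (measurableTypeR R) R, is_acip p nu ->
         forall A, measurable A -> nu A = mu A),
      is_ergodic p mu
    & has_bounded_density mu].

Definition continuous_curve (R : realType) (U : set 'cV[R]_3) : Prop :=
  exists2 g : R -> 'cV[R]_3,
    {within `[0, 1], continuous g} & U = g @` `[0, 1]%classic.

Definition opnorm (R : realType) (m n : nat) (H : 'M[R]_(m, n)) : R :=
  sup [set `|H *m x| | x in [set x : 'cV[R]_n | `|x| <= 1]].

Definition independent_RVs (R : realType) (d d' : measure_display)
    (Omega : measurableType d) (T : measurableType d')
    (P : probability Omega R) (X : nat -> {RV P >-> T}) : Prop :=
  forall (J : seq nat) (B : nat -> set T),
    uniq J -> (forall j, measurable (B j)) ->
    (P (\bigcap_(j in [set` J]) (X j @^-1` B j)) =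
     \prod_(j <- J) P (X j @^-1` B j))%E.

(* Uniform distribution on the cube [-eps, eps]^n: the product of n copies of
   the uniform distribution on [-eps, eps], given by its values on boxes. *)
Definition uniform_on_cube (R : realType) (d : measure_display)
    (Omega : measurableType d) (P : probability Omega R) (n : nat)
    (eps : R) (eps_gt0 : 0 < eps) (X : {RV P >-> n.-tuple (measurableTypeR R)})
    : Prop :=
  forall A : 'I_n -> set (measurableTypeR R),
    (forall a, measurable (A a)) ->
    (distribution P X [set y | forall a, A a (tnth y a)] =
     \prod_(a < n) uniform_prob (gtrN eps_gt0) (A a))%E.

(* q is the density with respect to Lebesgue measure on R^3 of a probability
   carried by Lambda_geo; only its values on Lambda_geo matter. *)
Definition is_prior_density (R : realType) (p : lorenz_params R)
    (q : 'cV[R]_3 -> R) : Prop :=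
  let vec (x : measurableTypeR R * measurableTypeR R * measurableTypeR R) :=
    vec3 x.1.1 x.1.2 x.2 in
  [/\ (forall v, Lambda_geo p v -> 0 <= q v),
      measurable_fun (vec @^-1` Lambda_geo p) (q \o vec)
    & (\int[(lebesgue_measure \x lebesgue_measure) \x lebesgue_measure]_(x in
          vec @^-1` Lambda_geo p) (q (vec x))%:E = 1)%E].

Definition observation (R : realType) (p : lorenz_params R) (h : R) (dO : nat)
    (H : 'M[R]_(dO, 3)) (u : 'cV[R]_3)
    (z : nat -> dO.-tuple (measurableTypeR R)) (i : nat) : 'cV[R]_dO :=
  H *m Psi_geo p (i%:R * h) u + \col_a tnth (z i) a.

(* Support of the filter at time t_k = k h, given the observations y. *)
Definition filter_support (R : realType) (p : lorenz_params R) (h : R)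
    (dO : nat) (H : 'M[R]_(dO, 3)) (q : 'cV[R]_3 -> R) (eps : R)
    (y : nat -> 'cV[R]_dO) (k : nat) : set 'cV[R]_3 :=
  [set Psi_geo p (k%:R * h) v | v in [set v |
    [/\ Lambda_geo p v, 0 < q v
      & forall i, (i <= k)%N ->
          `|y i - H *m Psi_geo p (i%:R * h) v| <= eps]]].

(* Extended-real valued; the element 0 gives the empty set diameter 0. *)
Definition diam (R : realType) (A : set 'cV[R]_3) : \bar R :=
  ereal_sup (0%E |` [set (`|v - w|)%:E | v in A & w in A]).

(* Main.v *)
Require Import Defs.
From HB Require Import structures.
From mathcomp Require Import all_boot all_order all_algebra.
From mathcomp Require Import all_classical all_reals all_analysis.
From mathcomp Require Import measurable_realfun ring lra.

Set Implicit Arguments.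
Unset Strict Implicit.
Unset Printing Implicit Defensive.

Import Order.TTheory GRing.Theory Num.Theory.
Import numFieldNormedType.Exports.

Local Open Scope classical_set_scope.
Local Open Scope ring_scope.

(** The return map of the section acts on the first coordinate by the expanding
    map [f] (slope above [sqrt 2]) and contracts the second coordinate.  Two
    trajectories that start at the same age from section points with the same
    second coordinate and visit the same branches of [f] therefore separate
    exponentially: if their first coordinates differ by [D] at the [n]-th
    return, they differ by at most [(3/4)^(n - m) * D] at the [m]-th one
    ([pullback_spec]).  The obstacle is the discontinuity [0] of [f], where the
    time spent in the linear phase is infinite.  Two starting points with
    relative distance [e] have return times that differ by up to [e / lambda_1],
    so the trajectories run out of phase, and an excursion that starts close to
    [0] contains many observation times.

    Everything is controlled along orbit segments with
    [|f^m x| >= b * (9/10)^(n - m)] for all [m <= n] ([slow_approach]).  Then the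
    relative distances are at most [(5/6)^(n - m) * D / b], the accumulated time
    shifts have the same order ([shadowing_return_times]), the number of
    observation times in the [m]-th excursion is of order [(10/9)^(n - m)], and
    since [5/6 * 10/9 < 1] the sum of the distances over all the observation
    times is at most a multiple of [D] that depends only on [b] and on the time
    step ([shadowing_sum]).  Conversely, shortly after the [n]-th return both
    trajectories are in the linear phase; a time shift is then visible in the
    third coordinate and cannot hide the difference [D] of the first ones
    ([linear_phase_separation]).  Here the time step has to be small compared with
    the shortest linear phase, which lasts [ln 2 / lambda_1].  So the points whose
    [n]-th return is displaced by [0 <= d <= r] form a curve with the required
    properties ([unstable_curve_at]), with constants that depend only on [b] and
    the time step.

    It remains to find infinitely many such [n] with the same [b].  The measure
    [mu_f] is invariant with bounded density, so the points at which the condition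
    fails for a given [n] have measure at most
    [sum_m C * b * (9/10)^(n - m) <= 10 * C * b], uniformly in [n].  Hence those at
    which it fails for all large [n] have measure of order [b], and the points
    that have this defect for every [b > 0] form a null set
    ([ae_infinitely_often_slow]).

    For the filter, take the point [v] of the curve whose final distance from the
    true trajectory is [d = eps / (d_o * C * |H|)].  It is consistent with an
    observation unless some coordinate of the noise falls into a set of
    probability [|(H (v(t_i) - u(t_i)))_a| / (2 * eps)].  These probabilities add
    up to at most [d_o * |H| * C * d / (2 * eps) = 1/2], so with probability at
    least [1/2] the support contains two points at distance [d]
    ([expected_diam_ge]).

    The flow is defined through the origin and the age of a point; that they are
    unique is the injectivity of excursions ([excursion_inj]). *)

(** * Elementary inequalities *)

Lemma expR_lipschitz (R : realType) (M a b : R) : a <= M -> b <= M ->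
  `|expR a - expR b| <= expR M * `|a - b|.
Proof.
wlog ab : a b / b <= a.
  move=> W aM bM; have [/W|/ltW/W] := leP b a; first exact.
  by rewrite distrC [`|a - b|]distrC; apply.
move=> aM _.
have -> : expR b = expR a * expR (b - a) by rewrite -expRD subrKC.
rewrite ger0_norm; last first.
  by rewrite -[X in X - _]mulr1 -mulrBr mulr_ge0 ?expR_ge0// subr_ge0 expR_le1 subr_le0.
rewrite ger0_norm ?subr_ge0// -[X in X - _]mulr1 -mulrBr.
apply: ler_pM; rewrite ?expR_ge0 ?ler_expR//.
  by rewrite subr_ge0 expR_le1 subr_le0.
by have := expR_ge1Dx (b - a); lra.
Qed.

Lemma ln_lipschitz (R : realType) (e a b : R) : 0 < a -> 0 < b ->
  `|a - b| <= e * a -> `|a - b| <= e * b -> `|ln a - ln b| <= e.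
Proof.
have W (x y : R) : 0 < x -> 0 < y -> `|x - y| <= e * y -> ln x - ln y <= e.
  move=> x0 y0 xy; rewrite -ln_div ?posrE//.
  have -> : x / y = 1 + (x - y) / y by rewrite mulrBl divff ?gt_eqF//; ring.
  apply: le_trans (le_ln1Dx _) _.
    rewrite mulrBl divff ?gt_eqF//.
    by have := divr_gt0 x0 y0; lra.
  by rewrite ler_pdivrMr//; have := ler_norm (x - y); lra.
move=> a0 b0 ab1 ab2; rewrite ler_norml; apply/andP; split; last exact: W.
by rewrite distrC in ab1; have := W _ _ b0 a0 ab1; lra.
Qed.

(** On the unit interval a power function turns relative errors into absolute
    ones, because [x `^ c = expR (c * ln x)] with a nonpositive exponent. *)
Lemma powR_lipschitz_rel (R : realType) (c e a b : R) : 0 <= c ->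
  0 < a <= 1 -> 0 < b <= 1 ->
  `|a - b| <= e * a -> `|a - b| <= e * b -> `|a `^ c - b `^ c| <= c * e.
Proof.
move=> c0 /andP[a0 a1] /andP[b0 b1] ab1 ab2.
rewrite /powR !gt_eqF//.
have la : ln a <= 0 by exact: ln_le0.
have lb : ln b <= 0 by exact: ln_le0.
apply: le_trans (expR_lipschitz (M := 0) _ _) _; rewrite ?mulr_ge0_le0//.
by rewrite expR0 mul1r -mulrBr normrM ger0_norm// ler_wpM2l// ln_lipschitz.
Qed.

Lemma continuous_powR_gt0 (R : realType) (c x : R) : 0 < x ->
  {for x, continuous ((@powR R) ^~ c)}.
Proof.
move=> x0; apply/differentiable_continuous/derivable1_diffP.
by apply: derivable_powR; rewrite in_itv/= x0.
Qed.

Lemma powR_lipschitz (R : realType) (c M a b : R) : 1 <= c ->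
  0 < a <= M -> 0 < b <= M ->
  `|a `^ c - b `^ c| <= c * M `^ (c - 1) * `|a - b|.
Proof.
move=> c1; wlog ab : a b / a < b.
  move=> W aM bM; have [ab|ab|->] := ltgtP a b; first exact: W.
    by rewrite distrC [`|a - b|]distrC; exact: W.
  by rewrite !subrr normr0 mulr0.
move=> /andP[a0 aM] /andP[b0 bM].
have gt0 x : x \in `[a, b] -> 0 < x.
  by rewrite in_itv => /andP[]/= ax _; exact: lt_le_trans ax.
have [||z zab zE] := @MVT R ((@powR R) ^~ c) (fun x => c * x `^ (c - 1)) a b ab.
- move=> x; rewrite in_itv => /andP[]/= ax _.
  by apply: is_derive1_powR; exact: lt_trans ax.
- apply: continuous_in_subspaceT => x; rewrite inE => xab.
  by apply: continuous_powR_gt0; exact: gt0.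
move: zab; rewrite in_itv => /andP[]/= az zb.
rewrite distrC zE [`|a - b|]distrC normrM; apply: ler_wpM2r => //.
rewrite normrM (ger0_norm (powR_ge0 _ _)) ger0_norm; last lra.
apply: ler_wpM2l; first lra.
have z0 : 0 < z by exact: lt_trans az.
apply: ge0_ler_powR; rewrite ?nnegrE; lra.
Qed.

Lemma sin_lipschitz (R : realType) (a b : R) : `|sin a - sin b| <= `|a - b|.
Proof.
wlog ab : a b / a < b.
  move=> W; have [ab|ab|->] := ltgtP a b; first exact: W.
    by rewrite distrC [`|a - b|]distrC; exact: W.
  by rewrite !subrr normr0.
have [|z _ zE] := @MVT R (@sin R) (@cos R) a b ab.
  by apply: continuous_subspaceT; exact: continuous_sin.
rewrite distrC zE [`|a - b|]distrC normrM -[leRHS]mul1r.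
by apply: ler_wpM2r => //; exact: cos_max.
Qed.

Lemma cos_lipschitz (R : realType) (a b : R) : `|cos a - cos b| <= `|a - b|.
Proof.
rewrite -!sinDpihalf; apply: le_trans (sin_lipschitz _ _) _.
by rewrite opprD addrACA subrr addr0.
Qed.

(** * Vectors of R^3 *)

Lemma vec3E0 (R : realType) (a b c : R) : vec3 a b c 0 0 = a.
Proof. by rewrite mxE. Qed.

Lemma vec3E1 (R : realType) (a b c : R) : vec3 a b c 1 0 = b.
Proof. by rewrite mxE. Qed.

Lemma vec3E2 (R : realType) (a b c : R) : vec3 a b c 2 0 = c.
Proof. by rewrite mxE. Qed.

Definition vec3E := (vec3E0, vec3E1, vec3E2).

Lemma vec3_eta (R : realType) (u : 'cV[R]_3) :
  u = vec3 (u 0 0) (u 1 0) (u 2 0).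
Proof.
apply/matrixP => i j; rewrite ord1 mxE.
case: i => [[|[|[|//]]] Hi] /=; congr (u _ _); exact/val_inj.
Qed.

Lemma vec3B (R : realType) (a b c a' b' c' : R) :
  vec3 a b c - vec3 a' b' c' = vec3 (a - a') (b - b') (c - c').
Proof. by rewrite [LHS]vec3_eta !mxE. Qed.

Lemma coord_le_norm (R : realType) (m n : nat) (A : 'M[R]_(m, n)) i j :
  `|A i j| <= `|A|.
Proof.
rewrite [leRHS]/Num.norm /= mx_normrE.
by apply: (@le_bigmax_cond _ _ _ _ (i, j) xpredT (fun ij => `|A ij.1 ij.2|)).
Qed.

Lemma mx_norm_leP (R : realType) (m n : nat) (A : 'M[R]_(m, n)) (b : R) :
  0 <= b -> (forall i j, `|A i j| <= b) -> `|A| <= b.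
Proof.
move=> b0 Ab; rewrite [leLHS]/Num.norm /= mx_normrE.
by apply/bigmax_leP; split => // ij _; exact: Ab.
Qed.

Lemma norm_vec3_le (R : realType) (a b c M : R) :
  `|a| <= M -> `|b| <= M -> `|c| <= M -> `|vec3 a b c| <= M.
Proof.
move=> aM bM cM; apply: mx_norm_leP; first exact: le_trans aM.
by move=> i j; rewrite mxE; case: i => [[|[|[|//]]] Hi].
Qed.

(** * Consequences of the conditions on the parameters *)

Section parameters.
Context (R : realType) (p : lorenz_params R) (p_adm : admissible p).

Lemma lam1_gt0 : 0 < lam1 p. Proof. by case: p_adm => -[? ? ?] _ _ _; lra. Qed.
Lemma lam2_gt0 : 0 < lam2 p. Proof. by case: p_adm => -[? ? ?] _ _ _; lra. Qed.
Lemma lam3_gt0 : 0 < lam3 p. Proof. by case: p_adm => -[? ? ?] _ _ _; lra. Qed.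

Lemma sqrt2_gt0 : 0 < Num.sqrt 2 :> R. Proof. by rewrite sqrtr_gt0. Qed.

Lemma sqrt2_sqr : Num.sqrt 2 * Num.sqrt 2 = 2 :> R.
Proof. by rewrite -expr2 sqr_sqrtr. Qed.

Lemma alpha_bounds : [/\ 2 / 3 < alpha p, alpha p < 1 & 1 < Num.sqrt 2 * alpha p].
Proof.
case: p_adm => _ /andP[a1 a2] _ _; split => //.
- apply: lt_trans a1; rewrite -[X in _ < X]mul1r ltr_pdivlMr ?sqrt2_gt0//.
  by have := sqrt2_sqr; have := sqrt2_gt0; nra.
- by rewrite mulrC -ltr_pdivrMr ?sqrt2_gt0// mul1r.
Qed.

Lemma alpha_gt0 : 0 < alpha p. Proof. by case: alpha_bounds; lra. Qed.

Lemma alpha_lt1 : alpha p < 1. Proof. by case: alpha_bounds. Qed.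

Lemma powR2_gt3 : 3 < 2 `^ beta p.
Proof.
case: p_adm => _ _ b _.
have l2 : 0 < ln 2 :> R by apply: ln_gt0; lra.
rewrite /powR gt_eqF; last lra.
rewrite -ltr_ln ?posrE ?expR_gt0// expRK.
have : ln 6 / ln 2 < beta p + 1 by lra.
rewrite ltr_pdivrMr// (_ : 6 = 3 * 2); last by ring.
by rewrite lnM ?posrE//; lra.
Qed.

Lemma beta_gt1 : 1 < beta p.
Proof.
rewrite ltNge; apply/negP => b1; have := powR2_gt3.
have l12 : 1 <= 2 :> R by lra.
by have := ler_powR l12 b1; rewrite powRr1//; lra.
Qed.

Lemma powR_half (c : R) : (1 / 2) `^ c * 2 `^ c = 1.
Proof. by rewrite -powRM ?divfK ?powR1 ?divr_ge0. Qed.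

Lemma powR_half_beta : (1 / 2) `^ beta p < 1 / 3.
Proof.
have := powR_half (beta p); have := powR2_gt3; have := powR_ge0 (1 / 2) (beta p).
by nra.
Qed.

Lemma powR2_alpha_bounds : Num.sqrt 2 <= 2 `^ alpha p < 2.
Proof.
have [a1 a2 _] := alpha_bounds; apply/andP; split.
  rewrite -powR12_sqrt//; apply: ler_powR; lra.
have : 2 `^ alpha p < 2 `^ 1 :> R.
  by rewrite /powR gt_eqF// ltr_expR ltr_pM2r ?ln_gt0//; lra.
by rewrite powRr1; lra.
Qed.

Lemma theta_alpha : 2 `^ alpha p < Num.sqrt 2 * (alpha p * theta p).
Proof.
case: p_adm => _ _ _ /andP[+ _]; rewrite ltr_pdivrMr; first by nra.
by rewrite mulr_gt0 ?sqrt2_gt0 ?alpha_gt0.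
Qed.

Lemma theta_gt1 : 1 < theta p.
Proof.
have [a1 a2 a3] := alpha_bounds; have := theta_alpha.
have /andP[+ _] := powR2_alpha_bounds; have := sqrt2_gt0 => s h1 h2.
have : Num.sqrt 2 * 1 < Num.sqrt 2 * (alpha p * theta p) by lra.
by rewrite ltr_pM2l//; nra.
Qed.

Lemma theta_lt2 : theta p < 2.
Proof.
by case: p_adm => _ _ _ /andP[_ +]; have /andP[_] := powR2_alpha_bounds; lra.
Qed.

Lemma theta_powR_half : theta p * (1 / 2) `^ alpha p < 1.
Proof.
case: p_adm => _ _ _ /andP[_ t]; have := powR_half (alpha p).
have : 0 < (1 / 2) `^ alpha p :> R by apply: powR_gt0; lra.
by nra.
Qed.

Lemma powR_half_alpha : 1 / 2 < (1 / 2) `^ alpha p.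
Proof.
have := powR_half (alpha p); have /andP[_] := powR2_alpha_bounds.
have : 0 < (1 / 2) `^ alpha p :> R by apply: powR_gt0; lra.
by nra.
Qed.

(** The inverse branches of the one-dimensional map contract by [3/4]: at the
    largest value [(1/2)^alpha] of their argument the lower bound on [theta]
    makes the slope smaller than [1/sqrt 2], and the gap between [1/sqrt 2] and
    [3/4] leaves room for a domain that is longer by [1/40].  This margin lets
    inverse images be taken at points that the branch restricted to
    [[-1/2, 1/2]] does not reach. *)
Lemma inverse_branch_contraction (a b : R) :
  0 < a <= (1 / 2) `^ alpha p + 1 / 40 -> 0 < b <= (1 / 2) `^ alpha p + 1 / 40 ->
  `|a `^ (alpha p)^-1 - b `^ (alpha p)^-1| <= 3 / 4 * theta p * `|a - b|.
Proof.
have [a1 a2 a3] := alpha_bounds; have a0 := alpha_gt0.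
move=> ha hb; apply: le_trans (powR_lipschitz (M := (1 / 2) `^ alpha p + 1 / 40) _ _ _) _ => //.
  by rewrite -[X in X <= _]invr1 lef_pV2 ?posrE//; lra.
apply: ler_wpM2r => //.
set c := (alpha p)^-1 - 1.
have c0 : 0 <= c by rewrite subr_ge0 -[X in X <= _]invr1 lef_pV2 ?posrE//; lra.
have c1 : c <= 1.
  rewrite lerBlDr; have -> : 1 + 1 = (1 / 2)^-1 :> R by field.
  by rewrite lef_pV2 ?posrE//; lra.
have hh := powR_half_alpha.
(* [1/40] is at most [1/20] of [(1/2)^alpha], which exceeds [1/2]. *)
have H1 : ((1 / 2) `^ alpha p + 1 / 40) `^ c <= (1 / 2 * 2 `^ alpha p) * (21 / 20).
  apply: (@le_trans _ _ (((1 / 2) `^ alpha p * (21 / 20)) `^ c)).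
    by apply: ge0_ler_powR => //; rewrite ?nnegrE; lra.
  rewrite powRM; [|lra|lra]; apply: ler_pM; rewrite ?powR_ge0//.
    rewrite -powRrM /c mulrBr mulfV ?gt_eqF// mulr1 powRB; last first.
      by apply/implyP => _; rewrite gt_eqF//; lra.
    rewrite powRr1; last lra.
    apply: ler_wpM2l; first lra.
    rewrite -[X in X <= _]mul1r ler_pdivrMr; last lra.
    by rewrite mulrC powR_half.
  have -> : 21 / 20 = (21 / 20) `^ 1 :> R by rewrite powRr1; lra.
  by rewrite powRr1; [apply: ler1_powR; lra|lra].
apply: le_trans (ler_wpM2l _ H1) _; first by rewrite invr_ge0; lra.
rewrite mulrC ler_pdivrMr//.
have := theta_alpha; have := sqrt2_sqr; have := sqrt2_gt0; have := theta_gt1.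
move=> t s0 s2 T.
(* [10/7 * (1/2) * (21/20) = 3/4] *)
have s3 : Num.sqrt 2 <= 10 / 7 :> R by nra.
have : Num.sqrt 2 * (alpha p * theta p) <= 10 / 7 * (alpha p * theta p).
  by apply: ler_wpM2r => //; apply: mulr_ge0; lra.
by lra.
Qed.

End parameters.

(** * Excursions determine their starting point and their age *)

Lemma rot_time_ge3 (R : realType) : 3 <= rot_time R.
Proof. by rewrite /rot_time; have := @pi_ge2 R; lra. Qed.

Lemma sin_rot_time (R : realType) : sin (rot_time R) = -1.
Proof.
have -> : rot_time R = pi / 2 + pi by rewrite /rot_time; field.
by rewrite sinDpi sin_pihalf.
Qed.

Lemma cos_rot_time (R : realType) : cos (rot_time R) = 0.
Proof.
have -> : rot_time R = pi / 2 + pi by rewrite /rot_time; field.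
by rewrite cosDpi cos_pihalf oppr0.
Qed.

Lemma cos_neg (R : realType) (s : R) : pi <= s < rot_time R -> cos s < 0.
Proof.
move=> /andP[s1 s2]; have -> : s = (s - pi) + pi by ring.
rewrite cosDpi oppr_lt0 cos_gt0_pihalf//.
by move: s2; rewrite /rot_time; have := @pi_ge2 R; lra.
Qed.

(** The rotation phase covers three quarters of a turn, so the angle is
    determined by the direction. *)
Lemma sin_cos_inj (R : realType) (s s' : R) :
  0 <= s < rot_time R -> 0 <= s' < rot_time R ->
  sin s = sin s' -> cos s = cos s' -> s = s'.
Proof.
wlog ss : s s' / s <= s'.
  move=> W hs hs' h1 h2; have [/W|/ltW/W] := leP s s'; first exact.
  by move=> h; apply/esym; apply: h.
move=> hs hs' h1 h2.
have c1 : cos (s' - s) = 1.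
  by rewrite cosB h1 h2 -!expr2 cos2Dsin2.
have [dpi|dpi] := leP (s' - s) pi.
  apply/eqP; rewrite eq_sym -subr_eq0; apply/eqP; apply: cos_inj.
  - by rewrite in_itv/= dpi; lra.
  - by rewrite in_itv/= lexx pi_ge0.
  - by rewrite c1 cos0.
by have := @cos_neg R (s' - s); rewrite c1; lra.
Qed.

Section excursions.
Context (R : realType) (p : lorenz_params R) (p_adm : admissible p).
Implicit Types (o : 'cV[R]_3) (s t : R).

Lemma section_vec3 o : section_S o -> o = vec3 (o 0 0) (o 1 0) 1.
Proof. by case=> _ _ o2; rewrite [LHS]vec3_eta o2. Qed.

Lemma exit_pointE o : [/\ exit_point p o 0 0 = Num.sg (o 0 0),
  exit_point p o 1 0 = o 1 0 * `|o 0 0| `^ beta p &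
  exit_point p o 2 0 = `|o 0 0| `^ alpha p].
Proof. by rewrite !vec3E. Qed.

(** Both wings in one formula, which reflects the symmetry of the model that
    changes the signs of the first two coordinates. *)
Lemma Psi_rot_exitE o s : o 0 0 != 0 ->
  Psi_rot p s (exit_point p o) =
  vec3 (Num.sg (o 0 0) * (1 + rot_radius p (exit_point p o) s * sin s))
       (o 1 0 * `|o 0 0| `^ beta p - Num.sg (o 0 0) / 4 * (s / rot_time R))
       (1 - rot_radius p (exit_point p o) s * cos s).
Proof.
move=> o0; rewrite /Psi_rot; have [-> -> _] := exit_pointE o.
have [x0|x0|x0] := ltgtP (o 0 0) 0; last by rewrite x0 eqxx in o0.
  rewrite ltr0_sg//; have -> : (-1 == 1 :> R) = false by apply/eqP; lra.
  by congr vec3; ring.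
by rewrite gtr0_sg// eqxx; congr vec3; ring.
Qed.

Lemma first_returnE o : o 0 0 != 0 ->
  first_return p o = vec3 (fmap_geo p (o 0 0))
    (o 1 0 * `|o 0 0| `^ beta p - Num.sg (o 0 0) / 4) 1.
Proof.
move=> o0; rewrite /first_return Psi_rot_exitE// sin_rot_time cos_rot_time.
rewrite /rot_radius; have [_ _ ->] := exit_pointE o.
have rt0 : rot_time R != 0 by rewrite gt_eqF//; have := rot_time_ge3 R; lra.
rewrite divff// /fmap_geo.
have [x0|x0|x0] := ltgtP (o 0 0) 0; last by rewrite x0 eqxx in o0.
  by rewrite ltr0_sg//; congr vec3; field.
by rewrite gtr0_sg//; congr vec3; field.
Qed.

Lemma first_return0 o : first_return p o 0 0 = fmap_geo p (o 0 0).
Proof.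
have [x0|x0] := eqVneq (o 0 0) 0; last by rewrite first_returnE// vec3E.
rewrite /first_return /Psi_rot /rot_radius; have [-> _ ->] := exit_pointE o.
rewrite x0 sgr0 normr0 eq_sym oner_eq0 vec3E /fmap_geo ltxx normr0.
rewrite powR0 ?gt_eqF ?(alpha_gt0 p_adm)// sin_rot_time.
have rt0 : rot_time R != 0 by rewrite gt_eqF//; have := rot_time_ge3 R; lra.
by rewrite divff//; field.
Qed.

Lemma section_powR_alpha o : section_S o -> `|o 0 0| `^ alpha p <= (1 / 2) `^ alpha p.
Proof.
case=> x1 _ _; apply: ge0_ler_powR; rewrite ?nnegrE ?(ltW (alpha_gt0 p_adm))//.
Qed.

Lemma section_powR_beta o : section_S o -> `|o 0 0| `^ beta p <= (1 / 2) `^ beta p.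
Proof.
have b := beta_gt1 p_adm.
case=> x1 _ _; apply: ge0_ler_powR; rewrite ?nnegrE//; lra.
Qed.

Lemma section_first_return o : section_S o -> o 0 0 != 0 ->
  section_S (first_return p o).
Proof.
move=> oS o0; rewrite first_returnE//; split; rewrite vec3E//.
  have := section_powR_alpha oS; have := powR_ge0 `|o 0 0| (alpha p).
  have := theta_powR_half p_adm; have := theta_gt1 p_adm.
  by rewrite /fmap_geo ler_norml; case: ifP => _; nra.
have := section_powR_beta oS; have := powR_half_beta p_adm.
have := powR_ge0 `|o 0 0| (beta p).
case: oS => _ y1 _ b0 b1 b2.
have h : `|o 1 0 * `|o 0 0| `^ beta p| <= 1 / 2 * (1 / 3).
  rewrite normrM; apply: ler_pM => //.
  by rewrite ger0_norm//; lra.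
have : `|Num.sg (o 0 0) / 4| <= 1 / 4.
  by rewrite normrM normr_sg o0 (@ger0_norm _ 4^-1) ?invr_ge0.
by move: h; rewrite !ler_norml; lra.
Qed.

Lemma tau_Sigma_ge0 o : section_S o -> 0 <= tau_Sigma p o.
Proof.
case=> x1 _ _; have l1 := lam1_gt0 p_adm.
rewrite /tau_Sigma mulr_ge0//; first by apply: divr_ge0; lra.
have [->|x0] := eqVneq (o 0 0) 0; first by rewrite normr0 invr0 mulr0 ln0.
by apply: ln_ge0; rewrite ler_pdivlMr ?normr_gt0//; lra.
Qed.

Lemma expR_tau_Sigma o : o 0 0 != 0 -> expR (lam1 p * tau_Sigma p o) = `|o 0 0|^-1.
Proof.
move=> x0; have l1 := lam1_gt0 p_adm.
rewrite /tau_Sigma mulrA mulrCA divff ?gt_eqF// !mul1r lnK ?mul1r//.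
by rewrite posrE invr_gt0 normr_gt0.
Qed.

Definition in_linear_phase o t := (o 0 0 == 0) || (t <= tau_Sigma p o).

Lemma excursion_linear o t : section_S o -> in_linear_phase o t -> 0 <= t ->
  [/\ excursion p o t = vec3 (o 0 0 * expR (lam1 p * t))
        (o 1 0 * expR (- lam2 p * t)) (expR (- lam3 p * t)),
      `|excursion p o t 0 0| <= 1 & excursion p o t 2 0 <= 1].
Proof.
move=> oS lin t0; rewrite /excursion; move: (lin); rewrite /in_linear_phase => ->.
have [l1 l3] := (lam1_gt0 p_adm, lam3_gt0 p_adm).
have [_ _ o2] := oS; rewrite /Psi_lin o2 mul1r !vec3E; split => //.
  have [->|x0] := eqVneq (o 0 0) 0; first by rewrite mul0r normr0.
  move: lin; rewrite /in_linear_phase (negbTE x0)/= => tt.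
  rewrite normrM (ger0_norm (expR_ge0 _)) -ler_pdivlMl ?normr_gt0// mulr1.
  by rewrite -expR_tau_Sigma// ler_expR ler_wpM2l// ltW.
by rewrite expR_le1; nra.
Qed.

Lemma excursion_rotation o t : ~~ in_linear_phase o t ->
  o 0 0 != 0 /\ excursion p o t = Psi_rot p (t - tau_Sigma p o) (exit_point p o).
Proof.
move=> nlin; rewrite /excursion; move: (nlin); rewrite /in_linear_phase => /negbTE ->.
by move: nlin; rewrite negb_or => /andP[].
Qed.

Lemma rot_radius_bounds o s : section_S o -> o 0 0 != 0 -> 0 <= s <= rot_time R ->
  0 < rot_radius p (exit_point p o) s <= 3 / 2.
Proof.
move=> oS o0 /andP[s0 s1]; rewrite /rot_radius; have [_ _ ->] := exit_pointE o.
have w0 : 0 < `|o 0 0| `^ alpha p by rewrite powR_gt0 ?normr_gt0.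
have := section_powR_alpha oS; have := theta_powR_half p_adm.
have := theta_gt1 p_adm; have := powR_half_alpha p_adm.
set w := `|o 0 0| `^ alpha p in w0 *; set m := (1 / 2) `^ alpha p.
move=> m0 t1 tm wm.
have rt0 : 0 < rot_time R by have := rot_time_ge3 R; lra.
set q := s / rot_time R.
have q0 : 0 <= q by rewrite divr_ge0// ltW.
have q1 : q <= 1 by rewrite ler_pdivrMr// mul1r.
have tw : theta p * w < 1 by nra.
have w1 : w < 1 by nra.
apply/andP; split.
  (* The radius interpolates between [1 - w] and [3/2 - theta * w]. *)
  have -> : 1 - w + (1 / 2 - (theta p - 1) * w) * q =
    (1 - w) * (1 - q) + (1 - theta p * w) * q + q / 2 by field.
  have [q2|q2] := leP q (1 / 2).
    have : 0 < (1 - w) * (1 - q) by apply: mulr_gt0; lra.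
    have : 0 <= (1 - theta p * w) * q by apply: mulr_ge0; lra.
    by lra.
  have : 0 <= (1 - w) * (1 - q) by apply: mulr_ge0; lra.
  have : 0 <= (1 - theta p * w) * q by apply: mulr_ge0; lra.
  by lra.
have : 0 <= (theta p - 1) * w by apply: mulr_ge0; lra.
have : 0 <= (theta p - 1) * w * q by apply: mulr_ge0 => //; apply: mulr_ge0; lra.
by lra.
Qed.

(** After half a turn the second coordinate has moved by at least [1/6], which
    exceeds its absolute value on [Sigma]; so the two wings pass on either
    side of the plane [u_2 = 0] where they overlap in projection. *)
Lemma wings_separated o s : section_S o -> o 0 0 != 0 -> pi <= s ->
  Num.sg (o 0 0) * (o 1 0 * `|o 0 0| `^ beta p - Num.sg (o 0 0) / 4 * (s / rot_time R)) < 0.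
Proof.
move=> oS o0 s1.
have := section_powR_beta oS; have := powR_half_beta p_adm.
have := powR_ge0 `|o 0 0| (beta p).
set b := `|o 0 0| `^ _ => b0 b1 b2.
have q : 2 / 3 <= s / rot_time R.
  by rewrite /rot_time ler_pdivlMr; have := @pi_ge2 R; lra.
have h : `|o 1 0 * b| < 1 / 6.
  have [_ y1 _] := oS; rewrite normrM (ger0_norm b0).
  apply: le_lt_trans (ler_wpM2r b0 y1) _; lra.
move: h; rewrite ltr_norml => /andP[].
have [x0|x0|x0] := ltgtP (o 0 0) 0; last by rewrite x0 eqxx in o0.
  by rewrite ltr0_sg//; lra.
by rewrite gtr0_sg//; lra.
Qed.

(** During the first half turn the first coordinate is beyond [Sigma], and later
    the third coordinate exceeds its values in the linear phase. *)
Lemma linear_rotation_disjoint o s v : section_S o -> o 0 0 != 0 ->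
  0 < s < rot_time R -> v = Psi_rot p s (exit_point p o) ->
  `|v 0 0| <= 1 -> v 2 0 <= 1 -> False.
Proof.
move=> oS o0 /andP[s0 s1] ->; rewrite Psi_rot_exitE// !vec3E.
rewrite normrM normr_sg o0 mul1r.
have /andP[r0 _] : 0 < rot_radius p (exit_point p o) s <= 3 / 2.
  by apply: rot_radius_bounds => //; lra.
have [s2|s2] := ltP s pi.
  have : 0 < rot_radius p (exit_point p o) s * sin s.
    by rewrite mulr_gt0// sin_gt0_pi// s0.
  by rewrite ler_norml; lra.
have : rot_radius p (exit_point p o) s * cos s < 0.
  by rewrite pmulr_rlt0// cos_neg// s2.
by lra.
Qed.

(** The radius never exceeds [3/2], so the left wing stays at [u_1 <= 1/2] while
    the right one is at [u_1 >= 1] during its first half turn, and vice versa.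
    When both are past the half turn the second coordinate separates them. *)
Lemma opposite_wings_disjoint o o' s s' : section_S o -> section_S o' ->
  0 < o 0 0 -> o' 0 0 < 0 -> 0 < s < rot_time R -> 0 < s' < rot_time R ->
  Psi_rot p s (exit_point p o) = Psi_rot p s' (exit_point p o') -> False.
Proof.
move=> oS oS' x0 x0' /andP[s0 s1] /andP[s0' s1'].
have nx : o 0 0 != 0 by rewrite gt_eqF.
have nx' : o' 0 0 != 0 by rewrite lt_eqF.
rewrite !Psi_rot_exitE// => E.
have := congr1 (fun v : 'cV[R]_3 => v 0 0) E.
have := congr1 (fun v : 'cV[R]_3 => v 1 0) E.
rewrite /= !vec3E {E}.
have := @wings_separated o s oS nx; have := @wings_separated o' s' oS' nx'.
rewrite (gtr0_sg x0) (ltr0_sg x0').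
have /andP[] : 0 < rot_radius p (exit_point p o) s <= 3 / 2.
  by apply: rot_radius_bounds => //; lra.
have /andP[] : 0 < rot_radius p (exit_point p o') s' <= 3 / 2.
  by apply: rot_radius_bounds => //; lra.
set r := rot_radius p _ s; set r' := rot_radius p _ s'.
move=> r0' r1' r0 r1 sep' sep E1 E0.
have b : -1 <= sin s by exact: sin_geN1.
have b' : -1 <= sin s' by exact: sin_geN1.
have c : 0 <= r' * (sin s' + 1) by apply: mulr_ge0; lra.
have d : 0 <= r * (sin s + 1) by apply: mulr_ge0; lra.
have [s2|s2] := leP s pi.
  have : 0 <= r * sin s by rewrite mulr_ge0 ?(ltW r0)// sin_ge0_pi// s2 ltW.
  by lra.
have [s2'|s2'] := leP s' pi.
  have : 0 <= r' * sin s' by rewrite mulr_ge0 ?(ltW r0')// sin_ge0_pi// s2' ltW.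
  by lra.
by have := sep (ltW s2); have := sep' (ltW s2'); lra.
Qed.

(** The first and third coordinates give the radius and the angle.  At a given
    angle the radius is strictly decreasing in the height [w_3] of the exit
    point, because [theta > 1], hence it determines [|u_1|]. *)
Lemma same_wing_inj o o' s s' : section_S o -> section_S o' ->
  o 0 0 != 0 -> Num.sg (o 0 0) = Num.sg (o' 0 0) ->
  0 < s < rot_time R -> 0 < s' < rot_time R ->
  Psi_rot p s (exit_point p o) = Psi_rot p s' (exit_point p o') ->
  o = o' /\ s = s'.
Proof.
move=> oS oS' nx sgE /andP[s0 s1] /andP[s0' s1'].
have nx' : o' 0 0 != 0 by rewrite -sgr_eq0 -sgE sgr_eq0.
rewrite !Psi_rot_exitE// => E.
have := congr1 (fun v : 'cV[R]_3 => v 0 0) E.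
have := congr1 (fun v : 'cV[R]_3 => v 1 0) E.
have := congr1 (fun v : 'cV[R]_3 => v 2 0) E.
rewrite /= !vec3E {E}.
have /andP[r0 _] : 0 < rot_radius p (exit_point p o) s <= 3 / 2.
  by apply: rot_radius_bounds => //; lra.
have /andP[r0' _] : 0 < rot_radius p (exit_point p o') s' <= 3 / 2.
  by apply: rot_radius_bounds => //; lra.
move=> E2 E1 E0.
have sg0 : Num.sg (o 0 0) != 0 by rewrite sgr_eq0.
have {}E0 : rot_radius p (exit_point p o) s * sin s =
            rot_radius p (exit_point p o') s' * sin s'.
  by move: E0; rewrite -sgE => /(mulfI sg0); lra.
have {}E2 : rot_radius p (exit_point p o) s * cos s =
            rot_radius p (exit_point p o') s' * cos s' by lra.
have rE : rot_radius p (exit_point p o) s = rot_radius p (exit_point p o') s'.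
  apply/eqP; rewrite -(@eqrXn2 _ 2) ?(ltW r0) ?(ltW r0')//; apply/eqP.
  rewrite -[LHS]mulr1 -(cos2Dsin2 s) -[RHS]mulr1 -(cos2Dsin2 s').
  by rewrite !mulrDr -!exprMn E0 E2.
have ss : s = s'.
  move: E0 E2; rewrite -rE => /mulfI E0 /mulfI E2.
  apply: sin_cos_inj; [lra|lra|..].
    by apply: E0; rewrite gt_eqF.
  by apply: E2; rewrite gt_eqF.
subst s'; split => //.
have rt0 : 0 < rot_time R by have := rot_time_ge3 R; lra.
have t1 := theta_gt1 p_adm.
have wE : `|o 0 0| `^ alpha p = `|o' 0 0| `^ alpha p.
  move: rE; rewrite /rot_radius; have [_ _ ->] := exit_pointE o.
  have [_ _ ->] := exit_pointE o'.
  have q0 : 0 < s / rot_time R by rewrite divr_gt0.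
  set w := _ `^ _; set w' := _ `^ _; set q := s / _ in q0 *.
  move=> rE; have : (w - w') * (1 + (theta p - 1) * q) = 0 by lra.
  move/eqP; rewrite mulf_eq0 => /orP[/eqP|/eqP h]; first lra.
  have : 0 < (theta p - 1) * q by apply: mulr_gt0; lra.
  by lra.
have xE : `|o 0 0| = `|o' 0 0|.
  by apply: (powR_injective (alpha_gt0 p_adm)); rewrite ?nnegrE.
have x0E : o 0 0 = o' 0 0 by rewrite [LHS]numEsg [RHS]numEsg xE sgE.
have y0E : o 1 0 = o' 1 0.
  have : `|o 0 0| `^ beta p != 0 by rewrite gt_eqF// powR_gt0 ?normr_gt0.
  by move=> /mulIf; apply; rewrite {2}xE; move: E1; rewrite sgE; lra.
by rewrite (section_vec3 oS) (section_vec3 oS') x0E y0E.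
Qed.

(** In the linear phase the third coordinate is a clock; the other cases are
    the separation lemmas above.  This makes the origin and the age of a point
    well defined, hence the flow can be computed along explicit excursions. *)
Theorem excursion_inj o o' t t' : section_S o -> section_S o' ->
  before_return p o t -> before_return p o' t' ->
  excursion p o t = excursion p o' t' -> o = o' /\ t = t'.
Proof.
move=> oS oS' /andP[t0 bt] /andP[t0' bt'] E.
have rot_range (u : 'cV[R]_3) r : ~~ in_linear_phase u r ->
    (u 0 0 == 0) || (r < tau_Sigma p u + rot_time R) ->
    0 < r - tau_Sigma p u < rot_time R.
  by rewrite negb_or => /andP[/negbTE ->]; rewrite -ltNge /= => h1 h2; lra.
have [lin|nlin] := boolP (in_linear_phase o t);
    have [lin'|nlin'] := boolP (in_linear_phase o' t').
- have [E1 _ _] := excursion_linear oS lin t0.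
  have [E2 _ _] := excursion_linear oS' lin' t0'.
  move: E; rewrite E1 E2 => E.
  have tt : t = t'.
    have := congr1 (fun v : 'cV[R]_3 => v 2 0) E.
    rewrite /= !vec3E => /expR_inj /mulfI; apply.
    by rewrite oppr_eq0 gt_eqF ?(lam3_gt0 p_adm).
  subst t'; split => //; rewrite (section_vec3 oS) (section_vec3 oS').
  have := congr1 (fun v : 'cV[R]_3 => v 0 0) E.
  have := congr1 (fun v : 'cV[R]_3 => v 1 0) E.
  have e0 x : expR x != 0 :> R by rewrite gt_eqF ?expR_gt0.
  by rewrite /= !vec3E => /(mulIf (e0 _)) -> /(mulIf (e0 _)) ->.
- have [x0' E2] := excursion_rotation nlin'.
  have [_ v0 v2] := excursion_linear oS lin t0.
  by case: (@linear_rotation_disjoint o' (t' - tau_Sigma p o') (excursion p o t)) => //;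
    [exact: rot_range|rewrite E].
- have [x0 E2] := excursion_rotation nlin.
  have [_ v0 v2] := excursion_linear oS' lin' t0'.
  by case: (@linear_rotation_disjoint o (t - tau_Sigma p o) (excursion p o' t')) => //;
    [exact: rot_range|rewrite -E].
- have [x0 E1] := excursion_rotation nlin; have [x0' E2] := excursion_rotation nlin'.
  have s1 := rot_range _ _ nlin bt; have s1' := rot_range _ _ nlin' bt'.
  move: E; rewrite E1 E2 => E.
  have same : Num.sg (o 0 0) = Num.sg (o' 0 0).
    have [y|y|y] := ltgtP (o 0 0) 0; last by rewrite y eqxx in x0.
    + have [y'|y'|y'] := ltgtP (o' 0 0) 0; last by rewrite y' eqxx in x0'.
        by rewrite !ltr0_sg.
      by case: (opposite_wings_disjoint oS' oS y' y s1' s1 (esym E)).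
    + have [y'|y'|y'] := ltgtP (o' 0 0) 0; last by rewrite y' eqxx in x0'.
        by case: (opposite_wings_disjoint oS oS' y y' s1 s1' E).
      by rewrite !gtr0_sg.
  have [oE sE] := same_wing_inj oS oS' x0 same s1 s1' E.
  by subst o'; split => //; lra.
Qed.

Lemma originP (v : 'cV[R]_3) : Lambda_geo p v ->
  [/\ section_S (origin p v), before_return p (origin p v) (age p v)
    & excursion p (origin p v) (age p v) = v].
Proof.
move=> [w [t [wS bt E]]].
have : section_S (origin p v) /\
    exists2 t, before_return p (origin p v) t & excursion p (origin p v) t = v.
  by rewrite /origin; case: xgetP => [//|/(_ w)]; case; split => //; exists t.
move=> [S1 [t1 b1 E1]]; split => //.
  by rewrite /age; case: xgetP => [? _ []//|/(_ t1)]; case.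
by rewrite /age; case: xgetP => [? _ []//|/(_ t1)]; case.
Qed.

Lemma Psi_geo_excursion o a t : section_S o -> before_return p o a ->
  Psi_geo p t (excursion p o a) = flow_from_S p o (a + t).
Proof.
move=> oS ba; have L : Lambda_geo p (excursion p o a) by exists o, a.
have [S1 b1 E1] := originP L.
by rewrite /Psi_geo; have [-> ->] := excursion_inj S1 oS b1 ba E1.
Qed.

End excursions.

(** * The flow along successive excursions *)

Section flow.
Context (R : realType) (p : lorenz_params R) (p_adm : admissible p).
Implicit Types (o : 'cV[R]_3) (s t : R) (m n : nat).

Definition return_time o : R := tau_Sigma p o + rot_time R.

Definition section_orbit m o : 'cV[R]_3 := iter m (first_return p) o.

Fixpoint nth_return_time m o : R :=
  if m is m'.+1 then return_time o + nth_return_time m' (first_return p o) else 0.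

Definition nonzero_upto m o : Prop :=
  forall i, (i < m)%N -> section_orbit i o 0 0 != 0.

Lemma section_orbitS m o : section_orbit m.+1 o = section_orbit m (first_return p o).
Proof. by rewrite /section_orbit iterSr. Qed.

Lemma section_orbit_fmap m o : section_orbit m o 0 0 = iter m (fmap_geo p) (o 0 0).
Proof. by elim: m => //= m <-; rewrite first_return0. Qed.

Lemma nonzero_uptoS m o : nonzero_upto m.+1 o ->
  o 0 0 != 0 /\ nonzero_upto m (first_return p o).
Proof.
move=> h; split; first exact: (h 0%N).
by move=> i im; rewrite -section_orbitS; exact: h.
Qed.

Lemma nonzero_upto_le m n o : (m <= n)%N -> nonzero_upto n o -> nonzero_upto m o.
Proof. by move=> mn h i im; apply: h; exact: leq_trans mn. Qed.

Lemma section_section_orbit m o : section_S o -> nonzero_upto m o ->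
  section_S (section_orbit m o).
Proof.
elim: m o => [//|m IH] o oS /nonzero_uptoS[ o0 h]; rewrite section_orbitS.
by apply: IH => //; exact: section_first_return.
Qed.

Lemma nth_return_timeS m o :
  nth_return_time m.+1 o = nth_return_time m o + return_time (section_orbit m o).
Proof.
elim: m o => [|m IH] o; first by rewrite /= addr0 add0r.
rewrite section_orbitS -[LHS]/(return_time o + nth_return_time m.+1 _).
by rewrite IH addrA.
Qed.

Lemma return_time_ge3 o : section_S o -> 3 <= return_time o.
Proof.
by move=> /(tau_Sigma_ge0 p_adm) h; rewrite /return_time; have := rot_time_ge3 R; lra.
Qed.

Lemma nth_return_time_ge m o : section_S o -> nonzero_upto m o ->
  m%:R <= nth_return_time m o.
Proof.
elim: m o => [|m IH] o oS; first by rewrite lexx.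
move=> /nonzero_uptoS[ o0 h] /=.
have := IH _ (section_first_return p_adm oS o0) h.
by have := return_time_ge3 oS; rewrite -natr1; lra.
Qed.

(** An excursion lasts longer than one unit of time, so the truncation of [t]
    bounds the number of returns before time [t]. *)
Lemma flow_from_S_rec_fuel n n' o t : section_S o -> 0 <= t ->
  (Num.truncn t <= n)%N -> (Num.truncn t <= n')%N ->
  flow_from_S_rec p n o t = flow_from_S_rec p n' o t.
Proof.
elim: n n' o t => [|n IH] n' o t oS t0.
  rewrite leqn0 => /eqP tr _.
  have t1 : t < 1.
    by have := truncnS_gt t; rewrite tr.
  suff b : before_return p o t by case: n' => [|n'] /=; rewrite b.
  rewrite /before_return t0; have := return_time_ge3 oS; rewrite /return_time => h.
  by apply/orP; right; lra.
move=> tn; case: n' => [|n'] tn' /=; case: ifP => // /negbT nb.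
  move: tn'; rewrite leqn0 => /eqP tr.
  have t1 : t < 1 by have := truncnS_gt t; rewrite tr.
  move: nb; rewrite /before_return t0/= negb_or -leNgt => /andP[_ le].
  by exfalso; have := return_time_ge3 oS; rewrite /return_time; lra.
move: nb; rewrite /before_return t0/= negb_or -leNgt => /andP[ o0 le].
have ge3 := return_time_ge3 oS; rewrite /return_time in ge3.
have tr : (Num.truncn (t - (tau_Sigma p o + rot_time R)) < Num.truncn t)%N.
  rewrite -(ltr_nat R); apply: (@le_lt_trans _ _ (t - 3)).
    by apply: (@le_trans _ _ (t - (tau_Sigma p o + rot_time R)));
      rewrite ?truncn_le ?subr_ge0//; lra.
  by have := truncnS_gt t; rewrite -natr1; lra.
apply: IH; rewrite ?subr_ge0//.
- exact: section_first_return.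
- by rewrite -ltnS; exact: leq_trans tn.
- by rewrite -ltnS; exact: leq_trans tn'.
Qed.

Lemma flow_from_S_excursion o t : before_return p o t ->
  flow_from_S p o t = excursion p o t.
Proof. by rewrite /flow_from_S; case: Num.truncn => [|n] /= ->. Qed.

Lemma flow_from_S_return o t : section_S o -> o 0 0 != 0 -> 0 <= t ->
  flow_from_S p o (return_time o + t) = flow_from_S p (first_return p o) t.
Proof.
move=> oS o0 t0; have ge3 := return_time_ge3 oS.
rewrite [LHS]/flow_from_S (@flow_from_S_rec_fuel _ (Num.truncn (return_time o + t)).+1)//; last lra.
rewrite /= /before_return (negbTE o0)/= -/(return_time o).
have -> : (return_time o + t < return_time o) = false by apply/negbTE; rewrite -leNgt; lra.
have -> : return_time o + t - return_time o = t by ring.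
rewrite andbF; apply: flow_from_S_rec_fuel => //; first exact: section_first_return.
by apply: le_truncn; lra.
Qed.

Lemma flow_from_S_orbit m o t : section_S o -> nonzero_upto m o -> 0 <= t ->
  flow_from_S p o (nth_return_time m o + t) = flow_from_S p (section_orbit m o) t.
Proof.
elim: m o => [|m IH] o oS; first by rewrite add0r.
move=> /nonzero_uptoS[ o0 h] t0; rewrite section_orbitS /= -addrA.
have o1S : section_S (first_return p o) by exact: section_first_return.
rewrite flow_from_S_return//; first exact: IH.
by rewrite addr_ge0// (le_trans _ (nth_return_time_ge o1S h)).
Qed.

(** * The flow is Lipschitz in time *)

(** A common bound for the speed in the two phases: each coordinate of the
    linear flow is at most [1] in absolute value, the radius of the rotation is
    at most [3/2], and it changes with speed at most [1]. *)
Definition speed : R := lam1 p + lam2 p + lam3 p + 3.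

Lemma speed_ge0 : 0 <= speed.
Proof.
by rewrite /speed; have := lam1_gt0 p_adm; have := lam2_gt0 p_adm; have := lam3_gt0 p_adm; lra.
Qed.

Lemma Psi_lin_lipschitz o t t' : section_S o -> o 0 0 != 0 ->
  0 <= t <= tau_Sigma p o -> 0 <= t' <= tau_Sigma p o ->
  `|Psi_lin p t o - Psi_lin p t' o| <= speed * `|t - t'|.
Proof.
move=> oS o0 /andP[t0 tt] /andP[t0' tt'].
have [[l1 l2] l3] := (lam1_gt0 p_adm, lam2_gt0 p_adm, lam3_gt0 p_adm).
have d0 : 0 <= `|t - t'| by [].
have le_speed c : c <= speed -> c * `|t - t'| <= speed * `|t - t'|.
  by move=> ?; rewrite ler_wpM2r.
have [_ y1 o2] := oS.
rewrite /Psi_lin vec3B -!mulrBr o2 mul1r; apply: norm_vec3_le.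
- rewrite normrM; apply: le_trans (ler_wpM2l (normr_ge0 _) (expR_lipschitz (M := lam1 p * tau_Sigma p o) _ _)) _.
  + by rewrite ler_wpM2l// ltW.
  + by rewrite ler_wpM2l// ltW.
  rewrite expR_tau_Sigma// mulrA divff ?normr_eq0// mul1r -mulrBr normrM.
  by rewrite (ger0_norm (ltW l1)); apply: le_speed; rewrite /speed; lra.
- rewrite normrM; apply: le_trans (ler_wpM2l (normr_ge0 _) (expR_lipschitz (M := 0) _ _)) _.
  + by nra.
  + by nra.
  rewrite expR0 mul1r -mulrBr normrM normrN (ger0_norm (ltW l2)).
  apply: (@le_trans _ _ (1 * (lam2 p * `|t - t'|))).
    by apply: ler_wpM2r; [rewrite mulr_ge0// ltW|lra].
  by rewrite mul1r; apply: le_speed; rewrite /speed; lra.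
- apply: le_trans (expR_lipschitz (M := 0) _ _) _; [nra|nra|].
  rewrite expR0 mul1r -mulrBr normrM normrN (ger0_norm (ltW l3)).
  by apply: le_speed; rewrite /speed; lra.
Qed.

Lemma rot_radius_lipschitz o s s' : section_S o -> o 0 0 != 0 ->
  `|rot_radius p (exit_point p o) s - rot_radius p (exit_point p o) s'| <= `|s - s'|.
Proof.
move=> oS o0; rewrite /rot_radius; have [_ _ ->] := exit_pointE p o.
have := section_powR_alpha p_adm oS; have := powR_ge0 `|o 0 0| (alpha p).
have := theta_powR_half p_adm; have := theta_gt1 p_adm.
set w := `|_| `^ _; set c := _ `^ _ => th tc w0 wc.
have rt := rot_time_ge3 R.
have -> : 1 - w + (1 / 2 - (theta p - 1) * w) * (s / rot_time R)
   - (1 - w + (1 / 2 - (theta p - 1) * w) * (s' / rot_time R)) =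
   (1 / 2 - (theta p - 1) * w) / rot_time R * (s - s').
  by field; rewrite gt_eqF//; lra.
rewrite normrM -[leRHS]mul1r ler_wpM2r// normrM normfV (ger0_norm (_ : 0 <= rot_time R)).
  rewrite ler_pdivrMr; last lra.
  by rewrite mul1r ler_norml; nra.
by lra.
Qed.

Lemma polar_lipschitz (r r' a a' : R) :
  `|a| <= 1 -> `|r'| <= 3 / 2 -> `|r * a - r' * a'| <= `|r - r'| + 3 / 2 * `|a - a'|.
Proof.
move=> a1 r1; have -> : r * a - r' * a' = (r - r') * a + r' * (a - a') by ring.
apply: le_trans (ler_normD _ _) _; rewrite !normrM; apply: lerD.
  by rewrite -[leRHS]mulr1 ler_wpM2l.
by rewrite ler_wpM2r.
Qed.

Lemma Psi_rot_lipschitz o s s' : section_S o -> o 0 0 != 0 ->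
  0 <= s <= rot_time R -> 0 <= s' <= rot_time R ->
  `|Psi_rot p s (exit_point p o) - Psi_rot p s' (exit_point p o)| <= speed * `|s - s'|.
Proof.
move=> oS o0 hs hs'; rewrite !Psi_rot_exitE// vec3B.
have rl := @rot_radius_lipschitz o s s' oS o0.
have /andP[r0 r1] := rot_radius_bounds p_adm oS o0 hs'.
set r := rot_radius p _ s in rl *; set r' := rot_radius p _ s' in rl r0 r1 *.
have rb : `|r'| <= 3 / 2 by rewrite ger0_norm// ltW.
have sp : 3 <= speed.
  by rewrite /speed; have := lam1_gt0 p_adm; have := lam2_gt0 p_adm; have := lam3_gt0 p_adm; lra.
have d0 : 0 <= `|s - s'| by [].
have D3 : 3 * `|s - s'| <= speed * `|s - s'| by rewrite ler_wpM2r.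
have sg1 : `|Num.sg (o 0 0)| = 1 by rewrite normr_sg o0.
apply: norm_vec3_le.
- rewrite -mulrBr normrM sg1 mul1r.
  have -> : 1 + r * sin s - (1 + r' * sin s') = r * sin s - r' * sin s' by ring.
  apply: le_trans (polar_lipschitz _ _ (sin_max s) rb) _ => //.
  by have := sin_lipschitz s s'; lra.
- have rt := rot_time_ge3 R.
  have -> : o 1 0 * `|o 0 0| `^ beta p - Num.sg (o 0 0) / 4 * (s / rot_time R) -
    (o 1 0 * `|o 0 0| `^ beta p - Num.sg (o 0 0) / 4 * (s' / rot_time R)) =
    Num.sg (o 0 0) * ((s' - s) / (4 * rot_time R)).
    by field; rewrite gt_eqF//; lra.
  rewrite normrM sg1 mul1r normrM [`|s' - s|]distrC; apply: le_trans D3.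
  rewrite [leLHS]mulrC ler_wpM2r// ger0_norm; last by rewrite invr_ge0; lra.
  by rewrite -div1r ler_pdivrMr; lra.
- have -> : 1 - r * cos s - (1 - r' * cos s') = - (r * cos s - r' * cos s') by ring.
  rewrite normrN; apply: le_trans (polar_lipschitz _ _ (cos_max s) rb) _ => //.
  by have := cos_lipschitz s s'; lra.
Qed.

Lemma Psi_lin_tau o : section_S o -> o 0 0 != 0 ->
  Psi_lin p (tau_Sigma p o) o = Psi_rot p 0 (exit_point p o).
Proof.
move=> oS o0; have l1 := lam1_gt0 p_adm; have [_ _ o2] := oS.
rewrite Psi_rot_exitE// /Psi_lin sin0 cos0 !mulr0 addr0 !mulr1 mul0r mulr0 subr0.
rewrite /rot_radius mul0r mulr0 addr0 o2 mul1r; have [_ _ ->] := exit_pointE p o.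
have xp : 0 < `|o 0 0| by rewrite normr_gt0.
have E (c : R) : expR (- c * tau_Sigma p o) = `|o 0 0| `^ (c / lam1 p).
  rewrite /powR gt_eqF// /tau_Sigma; congr expR.
  by rewrite !div1r lnV ?posrE//; field; rewrite gt_eqF.
rewrite expR_tau_Sigma// (E (lam2 p)) (E (lam3 p)); congr vec3; last by rewrite /alpha; ring.
by rewrite {1}[X in X * _](numEsg (o 0 0)) mulfK// normr_eq0.
Qed.

Lemma excursion_lipschitz o t t' : section_S o -> o 0 0 != 0 ->
  0 <= t <= return_time o -> 0 <= t' <= return_time o ->
  `|excursion p o t - excursion p o t'| <= speed * `|t - t'|.
Proof.
move=> oS o0; wlog tt : t t' / t <= t'.
  move=> W h h'; have [|/ltW] := leP t t'; first by move/W; apply.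
  by move=> tt; rewrite distrC [`|t - t'|]distrC; apply: W.
move=> /andP[t0 t1] /andP[t0' t1'].
rewrite /return_time in t1 t1'.
have tau0 := tau_Sigma_ge0 p_adm oS; have rt := rot_time_ge3 R.
rewrite /excursion (negbTE o0)/=.
have [l|l] := leP t (tau_Sigma p o); have [l'|l'] := leP t' (tau_Sigma p o).
- by apply: Psi_lin_lipschitz => //; lra.
- rewrite -[X in `|X - _|](subrK (Psi_lin p (tau_Sigma p o) o)) -addrA.
  apply: le_trans (ler_normD _ _) _; rewrite {2}Psi_lin_tau//.
  apply: le_trans (lerD (Psi_lin_lipschitz _ _ _ _) (Psi_rot_lipschitz _ _ _ _)) _ => //; try lra.
  have -> : `|t - t'| = `|t - tau_Sigma p o| + `|0 - (t' - tau_Sigma p o)|.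
    by rewrite !ler0_norm; lra.
  by rewrite mulrDr.
- by lra.
- apply: le_trans (Psi_rot_lipschitz _ _ _ _) _ => //; try lra.
  by have -> : t - tau_Sigma p o - (t' - tau_Sigma p o) = t - t' by ring.
Qed.

Lemma excursion_return o : section_S o -> o 0 0 != 0 ->
  excursion p o (return_time o) = first_return p o.
Proof.
move=> oS o0; rewrite /excursion (negbTE o0) /= /return_time.
have rt := rot_time_ge3 R.
have -> : (tau_Sigma p o + rot_time R <= tau_Sigma p o) = false.
  by apply/negbTE; rewrite -ltNge; lra.
by rewrite addrAC subrr add0r.
Qed.

Lemma flow_from_S0 o : section_S o -> flow_from_S p o 0 = o.
Proof.
move=> oS; have t0 := tau_Sigma_ge0 p_adm oS; have rt := rot_time_ge3 R.
rewrite flow_from_S_excursion; last first.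
  by rewrite /before_return lexx/=; apply/orP; right; lra.
have [] := @excursion_linear _ _ p_adm o 0 oS; rewrite ?lexx//.
  by rewrite /in_linear_phase t0 orbT.
by move=> -> _ _; rewrite !mulr0 expR0 !mulr1 [RHS]section_vec3.
Qed.

(** The pieces fit together continuously: the linear phase ends where the
    rotation starts, and the rotation ends at the next starting point. *)
Lemma flow_from_S_lipschitz n o t t' : section_S o -> nonzero_upto n o ->
  0 <= t <= nth_return_time n o -> 0 <= t' <= nth_return_time n o ->
  `|flow_from_S p o t - flow_from_S p o t'| <= speed * `|t - t'|.
Proof.
elim: n o t t' => [|n IH] o t t' oS.
  by move=> _ /= ? ?; have -> : t = t'; [lra|rewrite !subrr !normr0 mulr0].
move=> /nonzero_uptoS[ o0 h]; rewrite [nth_return_time _ _]/=.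
have o1S : section_S (first_return p o) by exact: section_first_return.
have ge3 := return_time_ge3 oS.
have Tge : 0 <= nth_return_time n (first_return p o).
  by rewrite (le_trans _ (nth_return_time_ge o1S h)).
wlog tt : t t' / t <= t'.
  move=> W h1 h1'; have [|/ltW] := leP t t'; first by move/W; apply.
  by move=> tt; rewrite distrC [`|t - t'|]distrC; apply: W.
move=> /andP[t0 t1] /andP[t0' t1'].
have flow1 r : 0 <= r <= return_time o -> flow_from_S p o r = excursion p o r.
  move=> /andP[r0]; rewrite le_eqVlt => /orP[/eqP rE|rl]; last first.
    by rewrite flow_from_S_excursion// /before_return r0 -/(return_time o) rl orbT.
  rewrite {1}rE -[return_time o]addr0 flow_from_S_return// flow_from_S0//.
  by rewrite rE excursion_return.
have flow2 r : return_time o <= r ->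
    flow_from_S p o r = flow_from_S p (first_return p o) (r - return_time o).
  move=> rl; rewrite -flow_from_S_return//; last lra.
  by congr flow_from_S; ring.
have [l|l] := leP t (return_time o); have [l'|l'] := leP t' (return_time o).
- by rewrite !flow1; [apply: excursion_lipschitz|..]; rewrite ?t0 ?t0'.
- rewrite -[X in `|X - _|](subrK (flow_from_S p o (return_time o))) -addrA.
  apply: le_trans (ler_normD _ _) _.
  rewrite {1}flow1 ?t0// {1}flow1 ?lexx ?andbT; last lra.
  rewrite flow2// flow2; last lra.
  apply: le_trans (lerD (excursion_lipschitz _ _ _ _) (IH _ _ _ _ _ _ _)) _ => //; try lra.
  have -> : `|t - t'| = `|t - return_time o| + `|return_time o - return_time o - (t' - return_time o)|.
    by rewrite subrr !ler0_norm; lra.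
  by rewrite mulrDr.
- by lra.
- rewrite flow2; last lra.
  rewrite flow2; last lra.
  apply: le_trans (IH _ _ _ _ _ _ _) _ => //; try lra.
  by have -> : t - return_time o - (t' - return_time o) = t - t' by ring.
Qed.

End flow.

(** * Inverse branches along an orbit *)

Section pullback.
Context (R : realType) (p : lorenz_params R) (p_adm : admissible p).
Implicit Types (x y d b r sigma : R) (m n : nat).

Definition inverse_branch sigma y : R :=
  sigma * ((1 / 2 + sigma * y) / theta p) `^ (alpha p)^-1.

(** The point near [x] whose [n]-th image is the [n]-th image of [x] plus [d]; it
    is obtained by following the branches visited by [x] backwards. *)
Fixpoint pullback n x d : R :=
  if n is n'.+1 then inverse_branch (Num.sg x) (pullback n' (fmap_geo p x) d)
  else x + d.

(** Seen backwards from time [n], the orbit comes near the discontinuity at most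
    at the rate [(9/10)^(n - m)], which is slower than the contraction [3/4] of
    the inverse branches.  Hence an interval at time [n] whose size depends only
    on [b], pulled back along the branches of the orbit, never meets the discontinuity. *)
Definition slow_approach b n x : Prop :=
  forall m, (m <= n)%N -> b * (9 / 10) ^+ (n - m) <= `|iter m (fmap_geo p) x|.

Lemma slow_approachS b n x :
  slow_approach b n.+1 x -> slow_approach b n (fmap_geo p x).
Proof. by move=> h m mn; rewrite -iterSr -subSS; exact: h. Qed.

Lemma fmap_geo_sg x : x != 0 ->
  fmap_geo p x = Num.sg x * (theta p * `|x| `^ alpha p - 1 / 2).
Proof.
move=> x0; rewrite /fmap_geo; have [xp|xn|xE] := ltgtP x 0.
- by rewrite ltr0_sg//; ring.
- by rewrite gtr0_sg//; ring.
- by rewrite xE eqxx in x0.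
Qed.

Lemma fmap_geo_bounded x : `|x| <= 1 / 2 -> `|fmap_geo p x| <= 1 / 2.
Proof.
move=> x1; have : section_S (vec3 x 0 1) by split; rewrite !vec3E// normr0; lra.
move=> /(section_powR_alpha p_adm); rewrite vec3E.
have := theta_powR_half p_adm; have := theta_gt1 p_adm.
have := powR_ge0 `|x| (alpha p).
by rewrite /fmap_geo ler_norml; case: ifP => _; nra.
Qed.

Lemma fmap_inverse_branch sigma y : `|sigma| = 1 -> 0 < 1 / 2 + sigma * y ->
  fmap_geo p (inverse_branch sigma y) = y /\
  Num.sg (inverse_branch sigma y) = sigma.
Proof.
move=> s1 A0; have t0 : 0 < theta p by have := theta_gt1 p_adm; lra.
have B0 : 0 < ((1 / 2 + sigma * y) / theta p) `^ (alpha p)^-1.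
  by rewrite powR_gt0// divr_gt0.
have s0 : sigma != 0 by rewrite -normr_gt0 s1.
have sgs : Num.sg sigma = sigma by rewrite {2}(numEsg sigma) s1 mulr1.
have sE : Num.sg (inverse_branch sigma y) = sigma.
  by rewrite /inverse_branch sgrM sgs (gtr0_sg B0) mulr1.
split => //; rewrite fmap_geo_sg ?sE; last first.
  by rewrite /inverse_branch mulf_neq0 // gt_eqF.
rewrite /inverse_branch normrM s1 (gtr0_norm B0) (mul1r (_ `^ _)) -powRrM mulVf; last first.
  by rewrite gt_eqF ?(alpha_gt0 p_adm).
rewrite powRr1; last by rewrite divr_ge0// ltW.
have ss : sigma * sigma = 1.
  by rewrite -{1}sgs -normrEsg.
rewrite [theta p * _]mulrC divfK ?gt_eqF//.
by have -> : 1 / 2 + sigma * y - 1 / 2 = sigma * y; [ring|rewrite mulrA ss mul1r].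
Qed.

Lemma inverse_branch_fmap x : x != 0 -> inverse_branch (Num.sg x) (fmap_geo p x) = x.
Proof.
move=> x0; have t0 : 0 < theta p by have := theta_gt1 p_adm; lra.
rewrite /inverse_branch fmap_geo_sg// [Num.sg x * (_ * _)]mulrA.
have -> : Num.sg x * Num.sg x = 1 by rewrite -expr2 sqr_sg x0.
have -> : (1 / 2 + 1 * (theta p * `|x| `^ alpha p - 1 / 2)) / theta p = `|x| `^ alpha p.
  by field; rewrite gt_eqF.
rewrite -powRrM mulfV ?gt_eqF ?(alpha_gt0 p_adm)// powRr1//.
by rewrite -numEsg.
Qed.

Lemma geometric_gap b r d n : 0 < b -> 0 <= d <= r -> r <= 9 / 20 * b ->
  (3 / 4) ^+ n * d <= 1 / 2 * (b * (9 / 10) ^+ n.+1).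
Proof.
move=> b0 /andP[d0 dr] rb; rewrite exprS.
have : (3 / 4) ^+ n <= (9 / 10) ^+ n :> R by apply: lerXn2r; rewrite ?nnegrE; lra.
have : 0 <= (3 / 4) ^+ n :> R by apply: exprn_ge0; lra.
set q := (3 / 4) ^+ n; set l := (9 / 10) ^+ n => q0 ql.
have : q * d <= l * (9 / 20 * b) by apply: ler_pM => //; lra.
by lra.
Qed.

(** The pulled back increment [(3/4)^n * d] stays below half the distance to the
    discontinuity, so the inverse branch of [x] applies, and below [1/40], so
    that branch contracts by [3/4]. *)
Lemma pullback_spec b r n x : 0 < b -> r <= 1 / 40 -> r <= 9 / 20 * b ->
  `|x| <= 1 / 2 -> slow_approach b n x ->
  [/\ pullback n x 0 = x,
      (forall d d', 0 <= d <= r -> 0 <= d' <= r ->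
        `|pullback n x d - pullback n x d'| <= (3 / 4) ^+ n * `|d - d'|)
    & (forall m d, (m <= n)%N -> 0 <= d <= r ->
        iter m (fmap_geo p) (pullback n x d) =
        pullback (n - m) (iter m (fmap_geo p) x) d)].
Proof.
move=> b0 r40 rb; elim: n x => [|n IH] x x1 sl.
  split => /=; first by rewrite addr0.
    by move=> d d' _ _; rewrite expr0 mul1r; have -> : x + d - (x + d') = d - d' by ring.
  by move=> m d; rewrite leqn0 => /eqP ->.
have t1 := theta_gt1 p_adm; have t0 : 0 < theta p by lra.
have xlow := sl 0%N isT; rewrite /= subn0 in xlow.
have lam0 : 0 < (9 / 10) ^+ n.+1 :> R by apply: exprn_gt0; lra.
have xgt0 : 0 < `|x| by apply: lt_le_trans xlow; exact: mulr_gt0.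
have x0 : x != 0 by rewrite -normr_gt0.
have [fx0 fxl fxi] := IH _ (fmap_geo_bounded x1) (slow_approachS sl).
have sg1 : `|Num.sg x| = 1 by rewrite normr_sg x0.
have ss : Num.sg x * Num.sg x = 1 by rewrite -expr2 sqr_sg x0.
have w1 : `|x| `^ alpha p <= (1 / 2) `^ alpha p.
  by apply: ge0_ler_powR; rewrite ?nnegrE ?(ltW (alpha_gt0 p_adm)).
have xw : `|x| <= `|x| `^ alpha p.
  apply: ger1_powR; rewrite ?xgt0/=; first by lra.
  exact: ltW (alpha_lt1 p_adm).
have AE d : (1 / 2 + Num.sg x * pullback n (fmap_geo p x) d) / theta p =
    `|x| `^ alpha p + Num.sg x * (pullback n (fmap_geo p x) d - fmap_geo p x) / theta p.
  have sf : Num.sg x * fmap_geo p x = theta p * `|x| `^ alpha p - 1 / 2.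
    by rewrite fmap_geo_sg// mulrA ss mul1r.
  by rewrite mulrBr sf; field; rewrite gt_eqF.
have near d : 0 <= d <= r ->
    `|Num.sg x * (pullback n (fmap_geo p x) d - fmap_geo p x) / theta p| <=
    Num.min (1 / 40) (1 / 2 * `|x|).
  move=> dr; rewrite normrM normrM sg1 (mul1r `|_|) normfV (gtr0_norm t0) ler_pdivrMr//.
  have d0 : 0 <= d by case/andP: dr.
  have := fxl d 0 dr; rewrite fx0 subr0 (ger0_norm d0) lexx /= => h.
  have {}h := h (le_trans d0 (proj2 (andP dr))).
  apply: le_trans h _; apply: (@le_trans _ _ (Num.min (1 / 40) (1 / 2 * `|x|))).
    rewrite le_min; apply/andP; split; last first.
      by apply: le_trans (geometric_gap n b0 dr rb) _; rewrite ler_wpM2l//; lra.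
    apply: (@le_trans _ _ (1 * d)); last by rewrite mul1r; move: dr; lra.
    by apply: ler_wpM2r => //; apply: exprn_ile1; lra.
  have : 0 <= Num.min (1 / 40) (1 / 2 * `|x|) by rewrite le_min; lra.
  by nra.
have Arange d : 0 <= d <= r ->
    0 < (1 / 2 + Num.sg x * pullback n (fmap_geo p x) d) / theta p
      <= (1 / 2) `^ alpha p + 1 / 40.
  move=> dr; rewrite AE; have := near d dr; rewrite le_min !ler_norml.
  by move=> /andP[/andP[? ?] /andP[? ?]]; apply/andP; split; lra.
have Agt0 d : 0 <= d <= r -> 0 < 1 / 2 + Num.sg x * pullback n (fmap_geo p x) d.
  by move=> /Arange/andP[]; rewrite pmulr_lgt0 ?invr_gt0.
split => /=.
- by rewrite fx0 inverse_branch_fmap.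
- move=> d d' dr dr'; rewrite /inverse_branch -mulrBr normrM sg1 (mul1r `|_|).
  apply: le_trans (inverse_branch_contraction p_adm (Arange _ dr) (Arange _ dr')) _.
  rewrite -mulrBl opprD addrACA subrr add0r -mulrBr normrM normrM sg1 (mul1r `|_|).
  rewrite normfV (gtr0_norm t0) -mulrA [theta p * _]mulrC divfK ?gt_eqF//.
  by rewrite exprS -[leRHS]mulrA; apply: ler_wpM2l; [lra|exact: fxl].
- case=> [|m] d; first by rewrite subn0.
  rewrite ltnS => mn dr; rewrite iterSr iterSr subSS.
  have [-> _] := fmap_inverse_branch sg1 (Agt0 _ dr).
  exact: fxi.
Qed.

End pullback.

(** * Comparison of two trajectories through the same branches *)

Section pullback_orbit.
Context (R : realType) (p : lorenz_params R) (p_adm : admissible p).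
Implicit Types (x d b r : R) (m n : nat).

Lemma iter_fmap_geo_bounded m x : `|x| <= 1 / 2 -> `|iter m (fmap_geo p) x| <= 1 / 2.
Proof. by move=> x1; elim: m => //= m; exact: fmap_geo_bounded. Qed.

Lemma slow_approach_iter b m n x : (m <= n)%N ->
  slow_approach p b n x -> slow_approach p b (n - m) (iter m (fmap_geo p) x).
Proof.
move=> mn h i ilt; rewrite -iterD -subnDA addnC; apply: h.
by rewrite addnC -leq_subRL.
Qed.

Lemma pullback_orbit_lipschitz b r n x m d d' : 0 < b -> r <= 1 / 40 -> r <= 9 / 20 * b ->
  `|x| <= 1 / 2 -> slow_approach p b n x -> (m <= n)%N ->
  0 <= d <= r -> 0 <= d' <= r ->
  `|iter m (fmap_geo p) (pullback p n x d) - iter m (fmap_geo p) (pullback p n x d')|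
    <= (3 / 4) ^+ (n - m) * `|d - d'|.
Proof.
move=> b0 r40 rb x1 sl mn dr dr'.
have [_ _ it] := pullback_spec p_adm b0 r40 rb x1 sl.
rewrite !it//.
have [_ + _] := pullback_spec p_adm b0 r40 rb (iter_fmap_geo_bounded m x1)
  (slow_approach_iter mn sl).
exact.
Qed.

Lemma pullback_orbit_branch b r n x m d : 0 < b -> r <= 1 / 40 -> r <= 9 / 20 * b ->
  `|x| <= 1 / 2 -> slow_approach p b n x -> (m <= n)%N -> 0 <= d <= r ->
  Num.sg (iter m (fmap_geo p) (pullback p n x d)) = Num.sg (iter m (fmap_geo p) x) /\
  b / 2 * (9 / 10) ^+ (n - m) <= `|iter m (fmap_geo p) (pullback p n x d)|.
Proof.
move=> b0 r40 rb x1 sl mn dr.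
have d0 : 0 <= d by case/andP: dr.
have r0 : 0 <= r by apply: le_trans d0 _; case/andP: dr.
have := pullback_orbit_lipschitz b0 r40 rb x1 sl mn dr (_ : 0 <= 0 <= r).
rewrite lexx r0 => /(_ isT); have [-> _ _] := pullback_spec p_adm b0 r40 rb x1 sl.
set X := iter m _ (pullback _ _ _ _); set x' := iter m _ x.
rewrite subr0 (ger0_norm d0) => h.
have gap := geometric_gap (n - m) b0 dr rb.
have low : b * (9 / 10) ^+ (n - m) <= `|x'| := sl m mn.
have l0 : 0 < (9 / 10) ^+ (n - m) :> R by apply: exprn_gt0; lra.
have {gap} : `|X - x'| <= 1 / 2 * (b * (9 / 10) ^+ (n - m)).
  apply: le_trans h (le_trans gap _); rewrite exprS.
  have : 0 < b * (9 / 10) ^+ (n - m) by exact: mulr_gt0.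
  by lra.
have : 0 < b * (9 / 10) ^+ (n - m) by exact: mulr_gt0.
move: low {h}; set B := b * _ => low B0.
have -> : b / 2 * (9 / 10) ^+ (n - m) = B / 2 by rewrite /B; field.
rewrite ler_norml => /andP[h1 h2].
have [xp|xn|xE] := ltgtP x' 0.
- move: low; rewrite (ltr0_norm xp) => low.
  have X0 : X < 0 by lra.
  by rewrite !ltr0_sg// ltr0_norm//; split=> //; lra.
- move: low; rewrite (gtr0_norm xn) => low.
  have X0 : 0 < X by lra.
  by rewrite !gtr0_sg// gtr0_norm//; split=> //; lra.
- by move: low; rewrite xE normr0; lra.
Qed.

End pullback_orbit.

Section pair.
Context (R : realType) (p : lorenz_params R) (p_adm : admissible p).
Implicit Types (o : 'cV[R]_3) (s t e : R) (m n : nat).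

(** The factor [beta] makes the last condition reproduce itself: the second
    coordinates of the images under the return map satisfy the same bound. *)
Definition close_pair e o o' : Prop :=
  [/\ section_S o /\ section_S o', o 0 0 != 0 /\ o' 0 0 != 0,
      Num.sg (o 0 0) = Num.sg (o' 0 0),
      `|o 0 0 - o' 0 0| <= e * `|o 0 0| /\ `|o 0 0 - o' 0 0| <= e * `|o' 0 0|
    & `|o 1 0 - o' 1 0| <= beta p * e].

Lemma sg_eq_distE (x x' : R) : Num.sg x = Num.sg x' -> `| `|x| - `|x'| | = `|x - x'|.
Proof.
move=> E; have [xp|xn|x0] := ltgtP x 0.
- have x'p : x' < 0 by rewrite -sgr_lt0 -E sgr_lt0.
  by rewrite (ltr0_norm xp) (ltr0_norm x'p) -normrN; congr (`|_|); ring.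
- have x'p : 0 < x' by rewrite -sgr_gt0 -E sgr_gt0.
  by rewrite (gtr0_norm xn) (gtr0_norm x'p).
- have x'0 : x' = 0 by apply/eqP; rewrite -sgr_eq0 -E x0 sgr0.
  by rewrite x0 x'0 !normr0.
Qed.

Section close.
Context (e : R) (o o' : 'cV[R]_3) (cl : close_pair e o o').

Lemma close_pair_ge0 : 0 <= e.
Proof.
case: cl => _ [x0 _] _ [h _] _.
have : 0 <= e * `|o 0 0| by exact: le_trans h.
by rewrite pmulr_lge0// normr_gt0.
Qed.

(** The length of the linear phase is a logarithm of [|u_1|], hence Lipschitz
    for relative distances. *)
Lemma close_pair_tau : `|tau_Sigma p o - tau_Sigma p o'| <= e / lam1 p.
Proof.
case: cl => _ [x0 x0'] sE [h h'] _; have l1 := lam1_gt0 p_adm.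
rewrite /tau_Sigma -mulrBr normrM (gtr0_norm (divr_gt0 ltr01 l1)) mulrC !div1r.
rewrite ler_wpM2r ?invr_ge0 ?(ltW l1)//.
rewrite !lnV ?posrE ?normr_gt0// opprK addrC distrC.
by apply: ln_lipschitz; rewrite ?normr_gt0 ?sg_eq_distE.
Qed.

Lemma norm_section_itv o1 : section_S o1 -> o1 0 0 != 0 -> 0 < `|o1 0 0| <= 1.
Proof. by case=> x1 _ _ x0; rewrite normr_gt0 x0/=; lra. Qed.

Lemma close_pair_powR c : 0 <= c ->
  `| `|o 0 0| `^ c - `|o' 0 0| `^ c | <= c * e.
Proof.
case: cl => -[oS oS'] [x0 x0'] sE [h h'] _ c0.
by apply: powR_lipschitz_rel; rewrite ?norm_section_itv ?sg_eq_distE.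
Qed.

Lemma close_pair_second :
  `|o 1 0 * `|o 0 0| `^ beta p - o' 1 0 * `|o' 0 0| `^ beta p| <= beta p * e.
Proof.
have b1 := beta_gt1 p_adm; have e0 := close_pair_ge0.
have := close_pair_powR (c := beta p).
case: cl => -[oS oS'] [x0 x0'] sE _ hy.
have := section_powR_beta p_adm oS; have := powR_half_beta p_adm.
have := powR_ge0 `|o 0 0| (beta p); have [_ y1 _] := oS'.
set P := _ `^ beta p; set P' := `|o' 0 0| `^ beta p; set Q := (1 / 2) `^ _.
move=> P0 Q3 PQ; have b0 : 0 <= beta p by lra.
move=> /(_ b0) hP.
have -> : o 1 0 * P - o' 1 0 * P' = (o 1 0 - o' 1 0) * P + o' 1 0 * (P - P') by ring.
apply: le_trans (ler_normD _ _) _; rewrite !normrM (ger0_norm P0).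
have be : 0 <= beta p * e by exact: mulr_ge0.
have : `|o 1 0 - o' 1 0| * P <= beta p * e * (1 / 2) by apply: ler_pM => //; lra.
have : `|o' 1 0| * `|P - P'| <= 1 / 2 * (beta p * e) by apply: ler_pM.
by lra.
Qed.

Lemma first_return1_close :
  `|first_return p o 1 0 - first_return p o' 1 0| <= beta p * e.
Proof.
have [_ [z z'] sE _ _] := cl; rewrite !first_returnE// !vec3E -sE.
by rewrite opprB addrA subrK; exact: close_pair_second.
Qed.

Lemma Psi_lin_close t : 0 <= t <= tau_Sigma p o ->
  `|Psi_lin p t o - Psi_lin p t o'| <= (2 + beta p) * e.
Proof.
have b1 := beta_gt1 p_adm; have e0 := close_pair_ge0.
have be : 0 <= beta p * e by apply: mulr_ge0; lra.
case: cl => -[oS oS'] [x0 x0'] sE [h _] hy /andP[t0 t1].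
have [_ _ o2] := oS; have [_ _ o2'] := oS'.
rewrite /Psi_lin vec3B -!mulrBl o2 o2' subrr mul0r; apply: norm_vec3_le.
- rewrite normrM (ger0_norm (expR_ge0 _)).
  have E : expR (lam1 p * t) <= `|o 0 0|^-1.
    by rewrite -(expR_tau_Sigma p_adm)// ler_expR ler_wpM2l// ltW// lam1_gt0.
  apply: (@le_trans _ _ (e * `|o 0 0| * `|o 0 0|^-1)).
    by apply: ler_pM => //; exact: expR_ge0.
  by rewrite mulfK ?normr_eq0//; lra.
- rewrite normrM (ger0_norm (expR_ge0 _)).
  have E : expR (- lam2 p * t) <= 1.
    by rewrite expR_le1; have := lam2_gt0 p_adm; nra.
  apply: (@le_trans _ _ (beta p * e * 1)).
    by apply: ler_pM => //; exact: expR_ge0.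
  by lra.
- by rewrite normr0; lra.
Qed.

Lemma Psi_rot_close s : 0 <= s <= rot_time R ->
  `|Psi_rot p s (exit_point p o) - Psi_rot p s (exit_point p o')| <= (2 + beta p) * e.
Proof.
have b1 := beta_gt1 p_adm; have e0 := close_pair_ge0.
have be : 0 <= beta p * e by apply: mulr_ge0; lra.
have y := close_pair_second.
have w := close_pair_powR (ltW (alpha_gt0 p_adm)).
case: cl => -[oS oS'] [x0 x0'] sE _ _ /andP[s0 s1].
rewrite !Psi_rot_exitE// vec3B -sE.
have sg1 : `|Num.sg (o 0 0)| = 1 by rewrite normr_sg x0.
have rt := rot_time_ge3 R.
have rr : `|rot_radius p (exit_point p o) s - rot_radius p (exit_point p o') s| <= 2 * e.
  rewrite /rot_radius; have [_ _ ->] := exit_pointE p o; have [_ _ ->] := exit_pointE p o'.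
  set a := `|o 0 0| `^ _ in w *; set a' := `|o' 0 0| `^ _ in w *; set q := s / _.
  have q0 : 0 <= q by rewrite divr_ge0//; lra.
  have q1 : q <= 1 by rewrite ler_pdivrMr; lra.
  have -> : 1 - a + (1 / 2 - (theta p - 1) * a) * q -
    (1 - a' + (1 / 2 - (theta p - 1) * a') * q) = - (1 + (theta p - 1) * q) * (a - a') by ring.
  have t1 := theta_gt1 p_adm; have t2 := theta_lt2 p_adm.
  have tq0 : 0 <= (theta p - 1) * q by apply: mulr_ge0; lra.
  have tq1 : 0 <= (theta p - 1) * (1 - q) by apply: mulr_ge0; lra.
  have c0 : 0 <= 1 + (theta p - 1) * q by lra.
  rewrite normrM normrN (ger0_norm c0).
  apply: ler_pM => //; first lra.
  apply: le_trans w _; rewrite -[leRHS]mul1r ler_wpM2r//.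
  exact: ltW (alpha_lt1 p_adm).
set r := rot_radius p _ s in rr *; set r' := rot_radius p (exit_point p o') s in rr *.
apply: norm_vec3_le.
- rewrite -mulrBr normrM sg1 mul1r.
  have -> : 1 + r * sin s - (1 + r' * sin s) = (r - r') * sin s by ring.
  rewrite normrM; apply: (@le_trans _ _ (2 * e * 1)); last by lra.
  by apply: ler_pM => //; exact: sin_max.
- set A := o 1 0 * _; set A' := o' 1 0 * _; set q := _ * (s / _).
  have -> : A - q - (A' - q) = A - A' by ring.
  by apply: le_trans y _; lra.
- have -> : 1 - r * cos s - (1 - r' * cos s) = - ((r - r') * cos s) by ring.
  rewrite normrN normrM; apply: (@le_trans _ _ (2 * e * 1)); last by lra.
  by apply: ler_pM => //; exact: cos_max.
Qed.

(** The two excursions are compared after a change of time that matches the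
    ends of the linear phases. *)
Lemma excursion_close s : 0 <= s < return_time p o ->
  exists2 s', 0 <= s' < return_time p o' &
    `|s - s'| <= e / lam1 p /\
    `|excursion p o s - excursion p o' s'| <= (2 + beta p + speed p / lam1 p) * e.
Proof.
have l1 := lam1_gt0 p_adm; have sp := speed_ge0 p_adm; have e0 := close_pair_ge0.
have tt := close_pair_tau.
have [[oS oS'] [x0 x0'] _ _ _] := cl.
have tau0 := tau_Sigma_ge0 p_adm oS; have tau0' := tau_Sigma_ge0 p_adm oS'.
have rt := rot_time_ge3 R.
have spe : 0 <= speed p / lam1 p * e by rewrite !mulr_ge0// invr_ge0 ltW.
have el : 0 <= e / lam1 p by rewrite divr_ge0// ltW.
rewrite /return_time; move=> /andP[s0 s1].
have [st|st] := leP s (tau_Sigma p o); last first.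
  exists (tau_Sigma p o' + (s - tau_Sigma p o)); first by apply/andP; split; lra.
  split.
    by have -> : s - (tau_Sigma p o' + (s - tau_Sigma p o)) = tau_Sigma p o - tau_Sigma p o' by ring.
  rewrite /excursion (negbTE x0) (negbTE x0')/= (leNgt s) st/=.
  have -> : (tau_Sigma p o' + (s - tau_Sigma p o) <= tau_Sigma p o') = false.
    by apply/negbTE; rewrite -ltNge; lra.
  rewrite [tau_Sigma p o' + _]addrC addrK.
  by apply: le_trans (Psi_rot_close _) _; lra.
have exl o1 t : o1 0 0 != 0 -> t <= tau_Sigma p o1 -> excursion p o1 t = Psi_lin p t o1.
  by move=> y0 ty; rewrite /excursion (negbTE y0) ty.
have [st'|st'] := leP s (tau_Sigma p o').
  exists s; first by apply/andP; split; lra.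
  rewrite subrr normr0; split => //.
  by rewrite !exl//; apply: le_trans (Psi_lin_close _) _; rewrite ?s0//; lra.
exists (tau_Sigma p o'); first by apply/andP; split; lra.
have d : `|s - tau_Sigma p o'| <= e / lam1 p.
  by apply: le_trans tt; rewrite !ger0_norm; lra.
split => //.
have -> : excursion p o s - excursion p o' (tau_Sigma p o') =
  (excursion p o s - excursion p o (tau_Sigma p o')) +
  (excursion p o (tau_Sigma p o') - excursion p o' (tau_Sigma p o')).
  by rewrite addrA subrK.
apply: le_trans (ler_normD _ _) _.
have A : `|excursion p o s - excursion p o (tau_Sigma p o')| <= speed p * (e / lam1 p).
  apply: le_trans (excursion_lipschitz p_adm oS x0 _ _) _; rewrite /return_time.
  - by apply/andP; split; lra.
  - by apply/andP; split; lra.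
  - exact: ler_wpM2l.
have B : `|excursion p o (tau_Sigma p o') - excursion p o' (tau_Sigma p o')|
    <= (2 + beta p) * e.
  by rewrite !exl//; [apply: Psi_lin_close|]; lra.
by apply: le_trans (lerD A B) _; rewrite mulrA mulrAC addrC -mulrDl.
Qed.

End close.

(** What two points obtained by pulling back along the same branches satisfy.  The
    conditions are symmetric, so that two perturbations of an orbit can also be
    compared with each other. *)
Definition shadowing (b : R) n (D : R) o o' : Prop :=
  [/\ 0 < b /\ 0 <= D, section_S o /\ section_S o', o 1 0 = o' 1 0
    & forall m, (m <= n)%N ->
      let x := section_orbit p m o 0 0 in let x' := section_orbit p m o' 0 0 in
      [/\ Num.sg x = Num.sg x', `|x - x'| <= (3 / 4) ^+ (n - m) * D,
          b * (9 / 10) ^+ (n - m) <= `|x| & b * (9 / 10) ^+ (n - m) <= `|x'|]].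

(** An absolute distance [(3/4)^(n - m) * D] divided by the distance
    [b * (9/10)^(n - m)] to the discontinuity. *)
Definition rel_dist (b : R) n (D : R) m : R := (5 / 6) ^+ (n - m) * (D / b).

Lemma rel_distS b n D m : (m < n)%N ->
  rel_dist b n D m = 5 / 6 * rel_dist b n D m.+1.
Proof. by move=> mn; rewrite /rel_dist -(subnSK mn) exprS mulrA. Qed.

Section shadow.
Context (b : R) (n : nat) (D : R) (o o' : 'cV[R]_3) (sh : shadowing b n D o o').

Lemma shadowing_nonzero : nonzero_upto p n.+1 o /\ nonzero_upto p n.+1 o'.
Proof.
case: sh => -[b0 _] _ _ h; split=> m mn; have [_ _ l l'] := h m mn.
  rewrite -normr_gt0; apply: lt_le_trans l; rewrite mulr_gt0// exprn_gt0//; lra.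
rewrite -normr_gt0; apply: lt_le_trans l'; rewrite mulr_gt0// exprn_gt0//; lra.
Qed.

Lemma rel_dist_ge0 m : 0 <= rel_dist b n D m.
Proof.
case: sh => -[b0 D0] _ _ _; rewrite /rel_dist; apply: mulr_ge0.
  by apply: exprn_ge0; lra.
by rewrite divr_ge0// ltW.
Qed.

Lemma rel_dist_leS m : (m < n)%N -> rel_dist b n D m <= rel_dist b n D m.+1.
Proof.
move=> mn; rewrite rel_distS//; have := rel_dist_ge0 m.+1.
by set r := rel_dist _ _ _ _; lra.
Qed.

Lemma shadowing_close m : (m <= n)%N ->
  close_pair (rel_dist b n D m) (section_orbit p m o) (section_orbit p m o').
Proof.
have [nz nz'] := shadowing_nonzero.
case: (sh) => -[b0 D0] [oS oS'] yE h; have b1 := beta_gt1 p_adm.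
have step k : (k <= n)%N -> section_S (section_orbit p k o) /\ section_S (section_orbit p k o').
  move=> kn; split; apply: section_section_orbit => //.
    exact: nonzero_upto_le (leqW kn) nz.
  exact: nonzero_upto_le (leqW kn) nz'.
have rel k (z : R) : (k <= n)%N -> b * (9 / 10) ^+ (n - k) <= z ->
    (3 / 4) ^+ (n - k) * D <= rel_dist b n D k * z.
  move=> kn hz; rewrite /rel_dist.
  apply: (@le_trans _ _ ((5 / 6) ^+ (n - k) * (D / b) * (b * (9 / 10) ^+ (n - k)))); last first.
    by rewrite ler_wpM2l//; exact: rel_dist_ge0.
  have -> : (5 / 6) ^+ (n - k) * (D / b) * (b * (9 / 10) ^+ (n - k)) =
    ((5 / 6) ^+ (n - k) * (9 / 10) ^+ (n - k)) * D by field; rewrite gt_eqF.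
  by rewrite -exprMn (_ : 5 / 6 * (9 / 10) = 3 / 4)//; field.
elim: m => [|m IH] mn.
  have [S1 S2] := step _ mn; have [sE xx l l'] := h 0%N mn.
  split => //=.
  - by split; [exact: (nz 0%N isT)|exact: (nz' 0%N isT)].
  - by split; [exact: le_trans xx (rel _ _ mn l)|exact: le_trans xx (rel _ _ mn l')].
  - by rewrite yE subrr normr0; apply: mulr_ge0; [lra|exact: rel_dist_ge0].
have cl := IH (ltnW mn).
have [S1 S2] := step _ mn; have [sE xx l l'] := h m.+1 mn.
split.
- by split.
- by split; [exact: nz|exact: nz'].
- exact: sE.
- by split; [exact: le_trans xx (rel _ _ mn l)|exact: le_trans xx (rel _ _ mn l')].
- apply: le_trans (first_return1_close cl) _.
  by apply: ler_wpM2l; [exact: ltW (lt_trans ltr01 b1)|exact: rel_dist_leS].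
Qed.

(** The time shifts accumulate along the orbit, but they grow geometrically, so
    the total is comparable to the last one. *)
Lemma shadowing_return_times j : (j <= n)%N ->
  `|nth_return_time p j o - nth_return_time p j o'| <= 5 / lam1 p * rel_dist b n D j.
Proof.
have l1 := lam1_gt0 p_adm.
elim: j => [|j IH] jn.
  by rewrite subrr normr0 mulr_ge0 ?rel_dist_ge0// divr_ge0// ltW.
rewrite !nth_return_timeS.
set T := nth_return_time p j o in IH *; set T' := nth_return_time p j o' in IH *.
have := close_pair_tau (shadowing_close (ltnW jn)).
have := IH (ltnW jn); rewrite rel_distS// /return_time.
set r := tau_Sigma p _; set r' := tau_Sigma p _ => h1 h2.
have -> : T + (r + rot_time R) - (T' + (r' + rot_time R)) = (T - T') + (r - r') by ring.
apply: le_trans (ler_normD _ _) _; apply: le_trans (lerD h1 h2) _.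
by rewrite le_eqVlt; apply/orP; left; apply/eqP; field; rewrite gt_eqF.
Qed.

(** Of the seven multiples of [speed / lambda_1], five come from the accumulated
    time shift and the other two from matching the phases of one excursion. *)
Definition comparison_const : R := 2 + beta p + 7 * (speed p / lam1 p).

Lemma comparison_const_ge0 : 0 <= comparison_const.
Proof.
have b1 := beta_gt1 p_adm; have l1 := lam1_gt0 p_adm; have sp := speed_ge0 p_adm.
have : 0 <= speed p / lam1 p by rewrite divr_ge0// ltW.
by rewrite /comparison_const; lra.
Qed.

(** At time [t] the two trajectories are compared with each other at matching
    phases of the [j]-th excursion; the difference between the phases and the
    actual times costs at most [speed] times the accumulated time shift. *)
Lemma shadowing_flow j t : (j <= n)%N ->
  nth_return_time p j o <= t < nth_return_time p j.+1 o ->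
  t <= nth_return_time p n.+1 o' ->
  `|flow_from_S p o t - flow_from_S p o' t| <= comparison_const * rel_dist b n D j.
Proof.
move=> jn; rewrite nth_return_timeS => /andP[t0 t1] t2.
have cl := shadowing_close jn; have tj := shadowing_return_times jn.
have [nz nz'] := shadowing_nonzero.
have [_ [oS oS'] _ _] := sh.
have nzj := nonzero_upto_le (leqW jn) nz; have nzj' := nonzero_upto_le (leqW jn) nz'.
have Tge0 : 0 <= nth_return_time p j o := le_trans (ler0n _ _) (nth_return_time_ge p_adm oS nzj).
have Tge0' : 0 <= nth_return_time p j o' := le_trans (ler0n _ _) (nth_return_time_ge p_adm oS' nzj').
have [|s' hs' [ss ee]] := excursion_close cl (s := t - nth_return_time p j o).
  by rewrite subr_ge0 t0/=; lra.
have sp := speed_ge0 p_adm; have l1 := lam1_gt0 p_adm.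
set T := nth_return_time p j o in t0 t1 tj ss ee Tge0 *.
set T' := nth_return_time p j o' in tj Tge0' *.
have E1 : flow_from_S p o t = excursion p (section_orbit p j o) (t - T).
  rewrite -{1}(subrK T t) addrC flow_from_S_orbit ?subr_ge0//.
  rewrite flow_from_S_excursion// /before_return subr_ge0 t0/=.
  by apply/orP; right; rewrite -/(return_time _ _); lra.
have E2 : flow_from_S p o' (T' + s') = excursion p (section_orbit p j o') s'.
  have /andP[s0 s1] := hs'.
  rewrite flow_from_S_orbit// flow_from_S_excursion// /before_return s0/=.
  by apply/orP; right.
have -> : flow_from_S p o t - flow_from_S p o' t =
  (excursion p (section_orbit p j o) (t - T) - excursion p (section_orbit p j o') s') +
  (flow_from_S p o' (T' + s') - flow_from_S p o' t) by rewrite E1 E2 addrA subrK.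
apply: le_trans (ler_normD _ _) _; apply: le_trans (lerD ee (lexx _)) _.
have lip : `|flow_from_S p o' (T' + s') - flow_from_S p o' t| <= speed p * `|T' + s' - t|.
  apply: (flow_from_S_lipschitz p_adm (n := n.+1) oS' nz'); last by rewrite t2; lra.
  have /andP[s0 s1] := hs'; rewrite addr_ge0//=.
  apply: (@le_trans _ _ (nth_return_time p j.+1 o')).
    by rewrite nth_return_timeS; rewrite -/T'; lra.
  have mono k : (j < k <= n.+1)%N -> nth_return_time p j.+1 o' <= nth_return_time p k o'.
    elim: k => // k IHk /andP[jk kn]; move: jk; rewrite ltnS leq_eqVlt => /orP[/eqP ->//|jk].
    apply: le_trans (IHk _) _; first by rewrite jk ltnW.
    rewrite nth_return_timeS lerDl; apply: le_trans (return_time_ge3 p_adm _); first by lra.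
    by apply: section_section_orbit => //; apply: nonzero_upto_le nz'; exact: ltnW.
  by apply: (mono n.+1); rewrite ltnS jn leqnn.
apply: le_trans (lerD (lexx _) lip) _.
have : `|T' + s' - t| <= 6 / lam1 p * rel_dist b n D j.
  have -> : T' + s' - t = - ((T - T') + (t - T - s')) by ring.
  rewrite normrN; apply: le_trans (ler_normD _ _) _; apply: le_trans (lerD tj ss) _.
  by rewrite le_eqVlt; apply/orP; left; apply/eqP; field; rewrite gt_eqF.
move=> /(ler_wpM2l sp) H; apply: le_trans (lerD (lexx _) H) _.
rewrite /comparison_const le_eqVlt; apply/orP; left; apply/eqP; field.
by rewrite gt_eqF.
Qed.

End shadow.

End pair.

(** * Summing the distances over the observation times *)

Lemma count_samples_le (R : realType) (a h c c' : R) (k : nat) : 0 < h -> c <= c' ->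
  \sum_(0 <= i < k) ((c <= a + i%:R * h < c')%R%:R : R) <= (c' - c) / h + 1.
Proof.
move=> h0 cc; set S := fun k => \sum_(0 <= i < k) ((c <= a + i%:R * h < c')%R%:R : R).
have L0 : 0 <= (c' - c) / h by rewrite divr_ge0 ?subr_ge0// ltW.
suff [//] : S k <= (c' - c) / h + 1 /\ (S k = 0 \/ S k * h <= a + k%:R * h - c).
elim: k => [|k [IH1 IH2]]; first by rewrite /S big_geq//; split; [lra|left].
have -> : S k.+1 = S k + ((c <= a + k%:R * h < c')%R%:R : R) by rewrite /S big_nat_recr.
case: (boolP (c <= a + k%:R * h < c')) => [/andP[h1 h2]|_] /=; last first.
  rewrite addr0; split => //; case: IH2 => [->|IH2]; [by left|right].
  by rewrite -natr1; lra.
have E : (S k + 1) * h <= a + k%:R * h - c + h.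
  by case: IH2 => [->|]; lra.
split; last by right; rewrite -natr1; lra.
rewrite -(ler_pM2r h0); apply: le_trans E _.
by rewrite [leRHS]mulrDl divfK ?gt_eqF//; lra.
Qed.

Lemma geometric_sum_le (R : realType) (q : R) (n : nat) : 0 <= q < 1 ->
  \sum_(0 <= j < n.+1) q ^+ (n - j) <= (1 - q)^-1.
Proof.
move=> /andP[q0 q1]; elim: n => [|n IH].
  by rewrite big_nat1 subnn expr0 -[leLHS]invr1 lef_pV2 ?posrE; lra.
rewrite big_nat_recr//= subnn expr0.
rewrite (eq_big_nat _ _ (F2 := fun j => q * q ^+ (n - j))); last first.
  by move=> j /andP[_ jn]; rewrite subSn// exprS.
rewrite -mulr_sumr; apply: le_trans (lerD (ler_wpM2l q0 IH) (lexx _)) _.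
by rewrite le_eqVlt; apply/orP; left; apply/eqP; field; rewrite gt_eqF; lra.
Qed.

Section sums.
Context (R : realType) (p : lorenz_params R) (p_adm : admissible p).
Implicit Types (o : 'cV[R]_3) (s t h a : R) (m n k : nat).

Lemma return_time_le o (b : R) m : section_S o -> 0 < b ->
  b * (9 / 10) ^+ m <= `|o 0 0| ->
  return_time p o <= (1 / lam1 p + rot_time R) * ((10 / 9) ^+ m / b).
Proof.
move=> oS b0 hx; have l1 := lam1_gt0 p_adm; have rt := rot_time_ge3 R.
have [x1 _ _] := oS.
have B0 : 0 < b * (9 / 10) ^+ m by rewrite mulr_gt0// exprn_gt0//; lra.
have E : (10 / 9) ^+ m / b = (b * (9 / 10) ^+ m)^-1.
  rewrite invfM -exprVn mulrC; congr (_ * _ ^+ _); by field.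
rewrite E; set B := b * _ in B0 hx *.
have xp : 0 < `|o 0 0| by lra.
have V : `|o 0 0|^-1 <= B^-1 by rewrite lef_pV2 ?posrE.
have B1 : 1 <= B^-1 by rewrite -[leLHS]invr1 lef_pV2 ?posrE; lra.
rewrite mulrDl /return_time; apply: lerD; last by rewrite -[leLHS]mulr1 ler_wpM2l//; lra.
rewrite /tau_Sigma ler_wpM2l ?divr_ge0 ?(ltW l1)// div1r.
by apply: le_trans V; apply: ltW; apply: ln_sublinear; rewrite invr_gt0.
Qed.

Lemma locate_excursion n o t : 0 <= t < nth_return_time p n o ->
  exists2 j, (j < n)%N & nth_return_time p j o <= t < nth_return_time p j.+1 o.
Proof.
elim: n => [|n IH]; first by rewrite /=; lra.
move=> /andP[t0 t1]; have [lt|le] := ltP t (nth_return_time p n o).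
  have [j jn jt] := IH (introT andP (conj t0 lt)).
  by exists j => //; exact: ltnW.
by exists n => //; rewrite le t1.
Qed.

(** [27/2] is the sum of the powers of [25/27 = 5/6 * 10/9]. *)
Definition sum_const (b h : R) : R :=
  comparison_const p * ((1 / lam1 p + rot_time R) / h + 1) / b ^+ 2 * (27 / 2).

(** The number of samples in the [j]-th excursion is at most proportional to
    the reciprocal of the distance to the discontinuity, hence of order
    [(10/9)^(n-j)], while the distance of the trajectories is of order
    [(5/6)^(n-j)]. *)
Lemma shadowing_sum (b : R) n (D : R) o o' h a k : shadowing p b n D o o' ->
  0 < h -> 0 <= a -> a + k%:R * h < nth_return_time p n.+1 o ->
  a + k%:R * h <= nth_return_time p n.+1 o' ->
  \sum_(0 <= i < k.+1)
    `|flow_from_S p o (a + i%:R * h) - flow_from_S p o' (a + i%:R * h)|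
  <= sum_const b h * D.
Proof.
move=> sh h0 a0 kt kt'; have [[b0 D0] [oS oS'] _ hm] := sh.
have K0 := comparison_const_ge0 p_adm; have l1 := lam1_gt0 p_adm; have rt := rot_time_ge3 R.
have [nz _] := shadowing_nonzero sh.
set K := comparison_const p in K0 *.
pose ind (j i : nat) : R := (nth_return_time p j o <= a + i%:R * h < nth_return_time p j.+1 o)%R%:R.
have ind0 j i : 0 <= ind j i by rewrite /ind ler0n.
have term i : (0 <= i < k.+1)%N ->
    `|flow_from_S p o (a + i%:R * h) - flow_from_S p o' (a + i%:R * h)| <=
    \sum_(0 <= j < n.+1) ind j i * (K * rel_dist b n D j).
  move=> /andP[_ ik].
  have ih : i%:R * h <= k%:R * h by rewrite ler_wpM2r ?(ltW h0)// ler_nat -ltnS.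
  have ih0 : 0 <= i%:R * h by rewrite mulr_ge0// ltW.
  have [|j jn jt] := @locate_excursion n.+1 o (a + i%:R * h); first by apply/andP; split; lra.
  rewrite (big_cat_nat (n := j))//=; last exact: ltnW.
  rewrite [X in _ <= _ + X]big_ltn//.
  have pos m : 0 <= ind m i * (K * rel_dist b n D m).
    by apply: mulr_ge0 => //; apply: mulr_ge0 => //; exact: rel_dist_ge0 sh _.
  have -> : ind j i = 1 by rewrite /ind jt.
  rewrite mul1r addrCA.
  have le2 : a + i%:R * h <= nth_return_time p n.+1 o' by lra.
  apply: le_trans (shadowing_flow p_adm sh (_ : (j <= n)%N) jt le2) _ => //.
  by rewrite lerDl; apply: addr_ge0; apply: sumr_ge0.
apply: le_trans (ler_sum_nat term) _.
rewrite exchange_big_nat /=.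
have per_excursion j : (0 <= j < n.+1)%N ->
    \sum_(0 <= i < k.+1) ind j i * (K * rel_dist b n D j) <=
    K * ((1 / lam1 p + rot_time R) / h + 1) / b ^+ 2 * D * (25 / 27) ^+ (n - j).
  move=> /andP[_ jn]; rewrite ltnS in jn.
  have nzj : nonzero_upto p j o by apply: nonzero_upto_le nz; exact: leqW.
  have jS : section_S (section_orbit p j o) by exact: section_section_orbit.
  have [_ _ low _] := hm j jn.
  have RL := return_time_le jS b0 low.
  have ret0 := return_time_ge3 p_adm jS.
  rewrite -mulr_suml.
  have TE : nth_return_time p j.+1 o - nth_return_time p j o =
      return_time p (section_orbit p j o) by rewrite nth_return_timeS addrAC subrr add0r.
  have cnt : \sum_(0 <= i < k.+1) ind j i <= return_time p (section_orbit p j o) / h + 1.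
    by rewrite -TE; apply: count_samples_le => //; rewrite -subr_ge0 TE; lra.
  have q0 : 0 < (10 / 9) ^+ (n - j) / b.
    by rewrite divr_gt0// exprn_gt0//; lra.
  have q1 : 1 <= (10 / 9) ^+ (n - j) / b.
    have [x1 _ _] := jS.
    rewrite ler_pdivlMr// mul1r.
    have : 1 <= (10 / 9) ^+ (n - j) :> R by apply: exprn_ege1; lra.
    have : b * (9 / 10) ^+ (n - j) * (10 / 9) ^+ (n - j) = b.
      by rewrite -mulrA -exprMn (_ : 9 / 10 * (10 / 9) = 1) ?expr1n ?mulr1//; field.
    have : b * (9 / 10) ^+ (n - j) * (10 / 9) ^+ (n - j) <= 1 * (10 / 9) ^+ (n - j).
      by apply: ler_wpM2r; [apply: exprn_ge0; lra|lra].
    by lra.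
  set L := 1 / lam1 p + rot_time R in RL *.
  have L0 : 0 <= L / h.
    by rewrite divr_ge0 ?(ltW h0)// /L addr_ge0 ?divr_ge0 ?(ltW l1)//; lra.
  have cnt2 : return_time p (section_orbit p j o) / h + 1 <=
      (L / h + 1) * ((10 / 9) ^+ (n - j) / b).
    rewrite [leRHS]mulrDl mul1r; apply: lerD => //.
    by rewrite mulrAC ler_wpM2r// invr_ge0 ltW.
  have Kr : 0 <= K * rel_dist b n D j by apply: mulr_ge0 => //; exact: rel_dist_ge0 sh _.
  apply: le_trans (ler_wpM2r Kr (le_trans cnt cnt2)) _.
  rewrite /rel_dist le_eqVlt; apply/orP; left; apply/eqP.
  have -> : (25 / 27) ^+ (n - j) = (10 / 9) ^+ (n - j) * (5 / 6) ^+ (n - j) :> R.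
    by rewrite -exprMn; congr (_ ^+ _); field.
  by field; rewrite (gt_eqF b0) (gt_eqF h0).
apply: le_trans (ler_sum_nat per_excursion) _.
rewrite -mulr_sumr /sum_const -/K [leRHS]mulrAC; apply: ler_wpM2l.
  rewrite !mulr_ge0// ?invr_ge0 ?exprn_ge0 ?(ltW b0)//.
  rewrite addr_ge0// divr_ge0 ?(ltW h0)// addr_ge0 ?divr_ge0 ?(ltW l1)//; lra.
apply: le_trans (geometric_sum_le n _) _; first lra.
by rewrite le_eqVlt; apply/orP; left; apply/eqP; field.
Qed.

Lemma ln2_le_tau o : section_S o -> o 0 0 != 0 -> ln 2 <= lam1 p * tau_Sigma p o.
Proof.
case=> x1 _ _ x0; have l1 := lam1_gt0 p_adm.
rewrite /tau_Sigma mulrA mulrCA divff ?gt_eqF// !mul1r.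
have xp : 0 < `|o 0 0| by rewrite normr_gt0.
rewrite ler_ln ?posrE ?invr_gt0//.
by rewrite -[leLHS]invrK lef_pV2 ?posrE ?invr_gt0//; lra.
Qed.

Definition separation_const (T : R) : R := 1 + lam1 p / (lam3 p * expR (- lam3 p * T)).

Lemma separation_const_gt0 T : 0 < separation_const T.
Proof.
rewrite /separation_const.
have : 0 < lam1 p / (lam3 p * expR (- lam3 p * T)).
  by rewrite divr_gt0 ?mulr_gt0 ?lam1_gt0 ?lam3_gt0 ?expR_gt0.
by lra.
Qed.

(** Near the section a time shift is visible in the third coordinate, so it
    cannot compensate a difference of the first coordinates. *)
Lemma linear_phase_separation o o' s s' T : section_S o -> section_S o' ->
  0 <= s <= T -> 0 <= s' <= T -> lam1 p * T <= ln 2 ->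
  `|o 0 0 - o' 0 0| <= separation_const T * `|Psi_lin p s o - Psi_lin p s' o'|.
Proof.
move=> oS oS' hs hs' hT; have [l1 l3] := (lam1_gt0 p_adm, lam3_gt0 p_adm).
have [x1 _ o2] := oS; have [x1' _ o2'] := oS'.
set V := Psi_lin p s o - _.
have h0 : `|o 0 0 * expR (lam1 p * s) - o' 0 0 * expR (lam1 p * s')| <= `|V|.
  by have := coord_le_norm V 0 0; rewrite /V /Psi_lin vec3B vec3E.
have h2 : `|expR (- lam3 p * s) - expR (- lam3 p * s')| <= `|V|.
  by have := coord_le_norm V 2 0; rewrite /V /Psi_lin vec3B vec3E o2 o2' !mul1r.
set E := lam3 p * expR (- lam3 p * T).
have E0 : 0 < E by rewrite mulr_gt0 ?expR_gt0.
have shift : E * `|s - s'| <= `|V|.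
  apply: le_trans h2.
  clear h0 V.
  wlog ss : s s' hs hs' / s <= s'.
    move=> W; have [ss|/ltW ss] := leP s s'; first exact: W.
    by rewrite distrC [leRHS]distrC; exact: W.
  rewrite ler0_norm ?subr_le0// opprB; apply: le_trans (ler_norm _).
  have -> : expR (- lam3 p * s) = expR (- lam3 p * s') * expR (lam3 p * (s' - s)).
    by rewrite -expRD; congr expR; ring.
  rewrite -[X in _ <= _ - X]mulr1 -mulrBr.
  have : expR (- lam3 p * T) <= expR (- lam3 p * s') by rewrite ler_expR; nra.
  have := expR_ge1Dx (lam3 p * (s' - s)).
  have : 0 <= lam3 p * (s' - s) by apply: mulr_ge0; lra.
  have : 0 < expR (- lam3 p * T) by exact: expR_gt0.
  rewrite /E; set A := expR _; set B := expR (_ * s'); set C := expR (lam3 p * _) => A0 d0 C1 AB.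
  rewrite -mulrA [expR _ * _]mulrC mulrA [_ * A]mulrC.
  by apply: ler_pM => //; lra.
have exp1 : 1 <= expR (lam1 p * s) by rewrite -expR0 ler_expR mulr_ge0 ?(ltW l1)//; lra.
have lip : `|expR (lam1 p * s) - expR (lam1 p * s')| <= 2 * (lam1 p * `|s - s'|).
  have hT' r : r <= T -> lam1 p * r <= ln 2.
    by move=> rT; apply: le_trans hT; rewrite ler_wpM2l// ltW.
  apply: le_trans (expR_lipschitz (M := ln 2) (hT' _ _) (hT' _ _)) _; [lra|lra|].
  by rewrite lnK ?posrE// -mulrBr normrM (gtr0_norm l1).
have D1 : `|o 0 0 - o' 0 0| <= `|V| + lam1 p * `|s - s'|.
  apply: (@le_trans _ _ (`|o 0 0 - o' 0 0| * expR (lam1 p * s))).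
    by rewrite -[leLHS]mulr1 ler_wpM2l.
  rewrite -[X in _ * X](ger0_norm (expR_ge0 _)) -normrM.
  have -> : (o 0 0 - o' 0 0) * expR (lam1 p * s) =
    (o 0 0 * expR (lam1 p * s) - o' 0 0 * expR (lam1 p * s')) -
     o' 0 0 * (expR (lam1 p * s) - expR (lam1 p * s')) by ring.
  apply: le_trans (ler_normB _ _) _; apply: lerD => //; rewrite normrM.
  apply: (@le_trans _ _ (1 / 2 * (2 * (lam1 p * `|s - s'|)))).
    exact: ler_pM.
  by lra.
apply: le_trans D1 _; rewrite /separation_const mulrDl mul1r lerD2l -/E.
rewrite -mulrA ler_wpM2l ?(ltW l1)//.
by rewrite mulrC ler_pdivlMr// mulrC.
Qed.

End sums.

(** * Unstable curves *)

Lemma lipschitz_within_continuous (R : realType) (V : normedModType R) (f : R -> V)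
    (L a b : R) : 0 <= L ->
  (forall x y, a <= x <= b -> a <= y <= b -> `|f x - f y| <= L * `|x - y|) ->
  {within `[a, b], continuous f}.
Proof.
move=> L0 lip; apply/subspace_continuousP => x; rewrite /= in_itv/= => xab.
apply/cvgrPdist_le => e e0; rewrite near_withinE.
have d0 : 0 < e / (L + 1) by rewrite divr_gt0//; lra.
near=> y; rewrite /= in_itv/= => yab.
apply: le_trans (lip x y xab yab) _.
have xy : `|x - y| <= e / (L + 1).
  by near: y; apply: (@cvgr_dist_le _ _ _ _ _ id x) => //; exact: cvg_id.
apply: (@le_trans _ _ ((L + 1) * (e / (L + 1)))).
  by apply: ler_pM => //; lra.
by rewrite mulrC divfK// gt_eqF//; lra.
Unshelve. all: by end_near. Qed.

Lemma image_segment01 (R : realType) (phi : R -> R) :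
  {within `[0, 1], continuous phi} -> phi 0 = 0 ->
  (forall t, 0 <= t <= 1 -> 0 <= phi t) ->
  exists2 M, phi @` `[0, 1]%classic = `[0, M]%classic &
    forall t, 0 <= t <= 1 -> phi t <= M.
Proof.
move=> cphi phi0 phige0.
have [c c01 cmax] := EVT_max ler01 cphi.
exists (phi c); last by move=> t t01; apply: cmax; rewrite in_itv.
move: c01; rewrite in_itv/= => /andP[c0 c1].
apply/seteqP; split => [y [t] |y].
  rewrite /= in_itv/= => t01 <-; rewrite in_itv/= phige0//=.
  by apply: cmax; rewrite in_itv.
rewrite /= in_itv/= => /andP[y0 y1].
have sub : {within `[0, c], continuous phi}.
  apply: continuous_subspaceW cphi => z; rewrite /= !in_itv/= => /andP[-> zc]/=.
  exact: le_trans c1.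
have [|z zc zE] := IVT c0 sub (v := y).
  by rewrite phi0 ge_min y0 le_max y1 orbT.
exists z => //; move: zc; rewrite /= !in_itv/= => /andP[-> zc]/=; exact: le_trans c1.
Qed.

Lemma expr_eventually_le (R : realType) (q c : R) : 0 <= q < 1 -> 0 < c ->
  exists N, forall n, (N <= n)%N -> q ^+ n <= c.
Proof.
move=> /andP[q0 q1] c0.
have : (fun n => q ^+ n) @ \oo --> (0 : R) by apply: cvg_expr; rewrite ger0_norm.
move/cvgrPdist_le => /(_ c c0) [N _ H]; exists N => n Nn.
have := H n Nn; rewrite /= sub0r normrN ger0_norm//; exact: exprn_ge0.
Qed.

Lemma term_le_sum (R : realType) (F : nat -> R) (i k : nat) : (i <= k)%N ->
  (forall j, 0 <= F j) -> F i <= \sum_(0 <= j < k.+1) F j.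
Proof.
move=> ik F0; rewrite (big_cat_nat (n := i))//=; last exact: leqW.
by rewrite [X in _ <= _ + X]big_ltn// addrCA lerDl addr_ge0// sumr_ge0.
Qed.

Section unstable_curve.
Context (R : realType) (p : lorenz_params R) (p_adm : admissible p).

Lemma sum_const_ge0 (b h : R) : 0 <= b -> 0 < h -> 0 <= sum_const p b h.
Proof.
move=> b0 h0; have l1 := lam1_gt0 p_adm; have rt := rot_time_ge3 R.
have K := comparison_const_ge0 p_adm.
have L : 0 <= 1 / lam1 p by rewrite divr_ge0// ltW.
have L2 : 0 <= (1 / lam1 p + rot_time R) / h by apply: divr_ge0; lra.
rewrite /sum_const; apply: mulr_ge0; last by lra.
by apply: divr_ge0; [apply: mulr_ge0 => //; lra|exact: exprn_ge0].
Qed.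

Context (u : 'cV[R]_3) (h b : R) (uL : Lambda_geo p u) (h0 : 0 < h)
  (hT : lam1 p * (3 * h) <= ln 2) (b0 : 0 < b).
Local Notation o := (origin p u).
Local Notation a := (age p u).
Local Notation x := (origin p u 0 0).
Hypotheses (x0 : x != 0) (x1 : `|x| < 1 / 2).

(** The first two bounds make the inverse branches contract; the last one makes
    the accumulated time shift at the end of the orbit segment at most [h]. *)
Definition curve_size : R :=
  Num.min (Num.min (1 / 40) (9 / 20 * b)) (h * lam1 p * (b / 2) / 5).
Local Notation r := curve_size.

Lemma curve_size_bounds :
  [/\ 0 < r, r <= 1 / 40, r <= 9 / 20 * b & 5 / lam1 p * (r / (b / 2)) <= h].
Proof.
have l1 := lam1_gt0 p_adm.
have b2 : 0 < b / 2 by rewrite divr_gt0.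
have B : 0 < h * lam1 p * (b / 2) / 5.
  by do ![apply: divr_gt0 => //|apply: mulr_gt0 => //].
have : r <= r by []; rewrite {2}/curve_size !le_min => /andP[/andP[r1 r2] r3].
split => //.
  rewrite /curve_size !lt_min B andbT divr_gt0//=.
  by apply: mulr_gt0 => //; exact: divr_gt0.
have -> : 5 / lam1 p * (r / (b / 2)) = r / (lam1 p * (b / 2) / 5).
  by field; rewrite !gt_eqF.
rewrite ler_pdivrMr; first by rewrite !mulrA; rewrite !mulrA in r3.
by rewrite divr_gt0// mulr_gt0.
Qed.

Section one_curve.
Context (n k : nat).
Hypotheses (sl : slow_approach p b n x)
  (n1 : (3 / 4) ^+ n <= 1 / 2 - `|x|)
  (n2 : (5 / 6) ^+ n <= (return_time p o - a) / 2 * (lam1 p * (b / 2)))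
  (ak : nth_return_time p n o + h <= a + k%:R * h <= nth_return_time p n o + 2 * h).

(** Only the first coordinate of the starting point is moved, and the age is kept:
    then the difference of the second coordinates and the time shift are both
    caused by the expanding direction, and they are small at early times. *)
Definition perturbed (d : R) : 'cV[R]_3 := vec3 (pullback p n x d) (o 1 0) 1.

Lemma perturbed0 : perturbed 0 = o.
Proof.
have [r0 r40 rb _] := curve_size_bounds; have [oS _ _] := originP uL.
have [E _ _] := pullback_spec p_adm b0 r40 rb (ltW x1) sl.
by rewrite /perturbed E [RHS]section_vec3.
Qed.

Lemma section_perturbed (d : R) : 0 <= d <= r -> section_S (perturbed d).
Proof.
have [r0 r40 rb _] := curve_size_bounds; have [[_ y1 _] _ _] := originP uL.
have q1 := n1; move=> dr; split; rewrite !vec3E//.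
have [E lip _] := pullback_spec p_adm b0 r40 rb (ltW x1) sl.
have := lip d 0 dr; rewrite lexx (ltW r0) E subr0 => /(_ isT) L.
have d1 : `|d| <= 1 by rewrite ger0_norm; lra.
have q0 : 0 <= (3 / 4) ^+ n :> R by apply: exprn_ge0; lra.
have : (3 / 4) ^+ n * `|d| <= (1 / 2 - `|x|) * 1 by apply: ler_pM.
by have := ler_normD (pullback p n x d - x) x; rewrite subrK; lra.
Qed.

Lemma shadowing_perturbed (d d' : R) : 0 <= d <= r -> 0 <= d' <= r ->
  shadowing p (b / 2) n `|d - d'| (perturbed d) (perturbed d').
Proof.
have [r0 r40 rb _] := curve_size_bounds.
move=> dr dr'; split.
- by split => //; rewrite divr_gt0.
- by split; exact: section_perturbed.
- by rewrite !vec3E.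
move=> m mn; rewrite /= !section_orbit_fmap// !vec3E.
have [s1 l1] := pullback_orbit_branch p_adm b0 r40 rb (ltW x1) sl mn dr.
have [s2 l2] := pullback_orbit_branch p_adm b0 r40 rb (ltW x1) sl mn dr'.
split => //; first by rewrite s1 s2.
exact: (pullback_orbit_lipschitz p_adm b0 r40 rb (ltW x1) sl mn dr dr').
Qed.

Lemma curve_size_itv0 : 0 <= (0 : R) <= r.
Proof. by rewrite lexx ltW//; have [] := curve_size_bounds. Qed.

Lemma nonzero_perturbed (d : R) : 0 <= d <= r -> nonzero_upto p n.+1 (perturbed d).
Proof.
by move=> dr; have [] := shadowing_nonzero (shadowing_perturbed dr curve_size_itv0).
Qed.

Lemma section_orbit_perturbed (d : R) : 0 <= d <= r ->
  section_S (section_orbit p n (perturbed d)).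
Proof.
move=> dr; apply: section_section_orbit => //; first exact: section_perturbed.
exact: nonzero_upto_le (leqnSn n) (nonzero_perturbed dr).
Qed.

(** At the observation time all the perturbed trajectories are in the linear phase
    of their [n]-th excursion: their time shift is at most [h], and the linear
    phase lasts at least [ln 2 / lambda_1 >= 3 * h]. *)
Lemma perturbed_times (d : R) : 0 <= d <= r ->
  0 <= a + k%:R * h - nth_return_time p n (perturbed d) <= 3 * h /\
  3 * h <= tau_Sigma p (section_orbit p n (perturbed d)).
Proof.
move=> dr; have l1 := lam1_gt0 p_adm; have [r0 r40 rb rh] := curve_size_bounds.
have := shadowing_return_times p_adm (shadowing_perturbed curve_size_itv0 dr) (leqnn n).
rewrite perturbed0 /rel_dist subnn expr0 mul1r sub0r normrN.
have -> : `|d| = d by rewrite ger0_norm//; case/andP: dr.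
have le : 5 / lam1 p * (d / (b / 2)) <= h.
  apply: le_trans rh; apply: ler_wpM2l; first by rewrite divr_ge0// ltW.
  by apply: ler_wpM2r; [rewrite invr_ge0 ltW// divr_gt0|case/andP: dr].
move=> /le_trans /(_ le); rewrite ler_norml => /andP[t1 t2].
split; first by move: ak; lra.
have := ln2_le_tau p_adm (section_orbit_perturbed dr) (nonzero_perturbed dr (ltnSn n)).
by move=> H; rewrite -(ler_pM2l l1); exact: le_trans hT H.
Qed.

Lemma perturbed_end (d : R) : 0 <= d <= r ->
  a + k%:R * h < nth_return_time p n.+1 (perturbed d).
Proof.
move=> dr; have [/andP[_ t1] t2] := perturbed_times dr.
by rewrite nth_return_timeS /return_time; have := rot_time_ge3 R; lra.
Qed.

Lemma before_return_perturbed (d : R) : 0 <= d <= r -> before_return p (perturbed d) a.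
Proof.
move=> dr; have l1 := lam1_gt0 p_adm; have [r0 r40 rb _] := curve_size_bounds.
have [oS /andP[a0 ba] _] := originP uL.
have := close_pair_tau p_adm (shadowing_close p_adm (shadowing_perturbed curve_size_itv0 dr) (leq0n n)).
rewrite [section_orbit _ _ _]/= [section_orbit _ _ (perturbed d)]/= perturbed0.
rewrite /rel_dist subn0 sub0r normrN.
have d0 : 0 <= d by case/andP: dr.
rewrite (ger0_norm d0) => H; rewrite /before_return a0/=; apply/orP; right.
move: ba; rewrite (negbTE x0)/= -/(return_time p o) => ba.
have B0 : 0 < lam1 p * (b / 2) by rewrite mulr_gt0 ?divr_gt0.
have : (5 / 6) ^+ n * (d / (b / 2)) / lam1 p <= (return_time p o - a) / 2.
  have -> : (5 / 6) ^+ n * (d / (b / 2)) / lam1 p = (5 / 6) ^+ n * d / (lam1 p * (b / 2)).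
    by field; rewrite !gt_eqF.
  rewrite ler_pdivrMr//; apply: le_trans n2.
  rewrite -[leRHS]mulr1; apply: ler_wpM2l; first by apply: exprn_ge0; lra.
  by move: dr; lra.
move=> /(le_trans H); rewrite ler_norml => /andP[_]; rewrite /return_time in ba *; lra.
Qed.

Local Notation point d := (excursion p (perturbed d) a).

Lemma Psi_geo_point d t : 0 <= d <= r ->
  Psi_geo p t (point d) = flow_from_S p (perturbed d) (a + t).
Proof.
move=> dr; apply: Psi_geo_excursion => //; first exact: section_perturbed.
exact: before_return_perturbed.
Qed.

Lemma Psi_geo_origin t : Psi_geo p t u = flow_from_S p (perturbed 0) (a + t).
Proof. by rewrite perturbed0. Qed.

Lemma sum_dist_perturbed (d d' : R) : 0 <= d <= r -> 0 <= d' <= r ->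
  \sum_(0 <= i < k.+1) `|flow_from_S p (perturbed d) (a + i%:R * h) -
                         flow_from_S p (perturbed d') (a + i%:R * h)|
  <= sum_const p (b / 2) h * `|d - d'|.
Proof.
move=> dr dr'; have [_ /andP[a0 _] _] := originP uL.
apply: shadowing_sum => //; [exact: shadowing_perturbed|exact: perturbed_end|].
by apply: ltW; exact: perturbed_end.
Qed.

Lemma dist_perturbed i d d' : (i <= k)%N -> 0 <= d <= r -> 0 <= d' <= r ->
  `|flow_from_S p (perturbed d) (a + i%:R * h) -
    flow_from_S p (perturbed d') (a + i%:R * h)|
  <= sum_const p (b / 2) h * `|d - d'|.
Proof.
move=> ik dr dr'; apply: le_trans (sum_dist_perturbed dr dr').
exact: (@term_le_sum _ (fun i => `|flow_from_S p (perturbed d) (a + i%:R * h) -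
                         flow_from_S p (perturbed d') (a + i%:R * h)|)).
Qed.

Lemma final_dist_perturbed (d : R) : 0 <= d <= r ->
  d <= separation_const p (3 * h) *
    `|flow_from_S p (perturbed d) (a + k%:R * h) - flow_from_S p (perturbed 0) (a + k%:R * h)|.
Proof.
move=> dr; have [r0 r40 rb _] := curve_size_bounds; have z := curve_size_itv0.
have E d1 : 0 <= d1 <= r -> flow_from_S p (perturbed d1) (a + k%:R * h) =
    Psi_lin p (a + k%:R * h - nth_return_time p n (perturbed d1)) (section_orbit p n (perturbed d1)).
  move=> dr1; have [/andP[t1 t2] t3] := perturbed_times dr1.
  have rt := rot_time_ge3 R.
  rewrite -{1}(subrK (nth_return_time p n (perturbed d1)) (a + k%:R * h)) addrC.
  rewrite flow_from_S_orbit//; first last.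
  - exact: nonzero_upto_le (leqnSn n) (nonzero_perturbed dr1).
  - exact: section_perturbed.
  rewrite flow_from_S_excursion; last first.
    by rewrite /before_return t1/=; apply/orP; right; lra.
  rewrite /excursion; have -> : a + k%:R * h - nth_return_time p n (perturbed d1) <=
    tau_Sigma p (section_orbit p n (perturbed d1)) by lra.
  by rewrite orbT.
have [t1 _] := perturbed_times dr; have [t2 _] := perturbed_times z.
have := linear_phase_separation p_adm (section_orbit_perturbed dr)
  (section_orbit_perturbed z) t1 t2 hT.
rewrite -!E// !section_orbit_fmap// !vec3E.
have [_ _ it] := pullback_spec p_adm b0 r40 rb (ltW x1) sl.
rewrite !it// subnn /= addr0 addrAC subrr add0r ger0_norm//.
by case/andP: dr.
Qed.

(** The final distance bounds the increment [d] from above, and the sum of all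
    distances is at most proportional to [d].  The same bound for two
    perturbations shows that the points and their final distances depend
    continuously on [d], so the final distances fill an interval. *)
Lemma unstable_curve_at : exists U M,
  [/\ continuous_curve U, U `<=` Lambda_geo p, r / separation_const p (3 * h) <= M,
      [set `|Psi_geo p (k%:R * h) v - Psi_geo p (k%:R * h) u| | v in U] = `[0, M]%classic
    & forall v, U v -> \sum_(0 <= i < k.+1)
          `|Psi_geo p (i%:R * h) v - Psi_geo p (i%:R * h) u|
        <= sum_const p (b / 2) h * separation_const p (3 * h) *
           `|Psi_geo p (k%:R * h) v - Psi_geo p (k%:R * h) u|].
Proof.
have [r0 _ _ _] := curve_size_bounds; have z := curve_size_itv0.
have C0 : 0 <= sum_const p (b / 2) h by rewrite sum_const_ge0 ?divr_ge0 ?ltW.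
have sep0 := separation_const_gt0 p_adm (3 * h).
have range t : 0 <= t <= 1 -> 0 <= r * t <= r by move=> /andP[? ?]; nra.
pose phi t := `|flow_from_S p (perturbed (r * t)) (a + k%:R * h) -
                flow_from_S p (perturbed 0) (a + k%:R * h)|.
have Lr : 0 <= sum_const p (b / 2) h * r by rewrite mulr_ge0// ltW.
have distr (t s : R) : sum_const p (b / 2) h * `|r * t - r * s| =
    sum_const p (b / 2) h * r * `|t - s|.
  by rewrite -mulrBr normrM (gtr0_norm r0) mulrA.
have cphi : {within `[0, 1], continuous phi}.
  apply: (lipschitz_within_continuous Lr) => t s ht hs.
  apply: le_trans (ler_dist_dist _ _) _; rewrite -distr.
  have -> (A B C : 'cV[R]_3) : A - C - (B - C) = A - B by rewrite opprB addrA subrK.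
  by apply: dist_perturbed => //; exact: range.
have [||M imM maxM] := image_segment01 cphi.
- by rewrite /phi mulr0 subrr normr0.
- by move=> t _; exact: normr_ge0.
exists ((fun t => point (r * t)) @` `[0, 1]%classic), M; split.
- exists (fun t => point (r * t)) => //.
  apply: (lipschitz_within_continuous Lr) => t s ht hs; rewrite -distr.
  have := dist_perturbed (leq0n k) (range _ ht) (range _ hs).
  by rewrite mul0r addr0 !flow_from_S_excursion//; apply: before_return_perturbed; exact: range.
- move=> v [t]; rewrite /= in_itv/= => /range dr <-.
  exists (perturbed (r * t)), a; split => //; first exact: section_perturbed.
  exact: before_return_perturbed.
- have := maxM 1; rewrite ler01 lexx => /(_ isT); apply: le_trans.
  rewrite ler_pdivrMr// mulrC /phi mulr1; apply: final_dist_perturbed.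
  by rewrite lexx ltW.
- rewrite -imM image_comp; apply: eq_imagel => t; rewrite /= in_itv/= => /range dr.
  by rewrite Psi_geo_point// Psi_geo_origin.
- move=> v [t]; rewrite /= in_itv/= => /range dr <-.
  rewrite (eq_bigr (fun i => `|flow_from_S p (perturbed (r * t)) (a + i%:R * h) -
    flow_from_S p (perturbed 0) (a + i%:R * h)|)); last first.
    by move=> i _; rewrite Psi_geo_point// Psi_geo_origin.
  rewrite Psi_geo_point// Psi_geo_origin.
  apply: le_trans (sum_dist_perturbed dr z) _.
  rewrite subr0 -mulrA; apply: ler_wpM2l => //.
  rewrite ger0_norm; first exact: final_dist_perturbed.
  by case/andP: dr.
Qed.

End one_curve.
End unstable_curve.

(** * Almost every orbit approaches the discontinuity slowly, infinitely often *)

Section recurrence.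
Context (R : realType) (p : lorenz_params R)
  (mu : probability (measurableTypeR R) R).
Hypotheses (mu_inv : forall A, measurable A -> mu (fmap_geo p @^-1` A) = mu A)
  (mu_dens : has_bounded_density mu).

Lemma measurable_fmap_geo :
  measurable_fun [set: measurableTypeR R] (fmap_geo p : measurableTypeR R -> measurableTypeR R).
Proof.
have m : measurable_fun [set: measurableTypeR R] (fun x : measurableTypeR R => `|x| `^ alpha p).
  by apply: (measurableT_comp (@measurable_powR R (alpha p))); exact: normr_measurable.
apply: measurable_fun_ifT => /=.
- exact: measurable_fun_ltr.
- by apply: measurable_funB => //; apply: measurable_funM.
- by apply: measurable_funD => //; apply: measurableT_comp => //; apply: measurable_funM.
Qed.

Lemma measurable_iter_fmap_geo m :
  measurable_fun [set: measurableTypeR R] (iter m (fmap_geo p) : measurableTypeR R -> measurableTypeR R).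
Proof.
elim: m => [|m IH]; first exact: measurable_id.
by rewrite [X in measurable_fun _ X](_ : _ = fmap_geo p \o iter m (fmap_geo p))//;
  apply: measurableT_comp IH; exact: measurable_fmap_geo.
Qed.

Lemma mu_iter_fmap_geo m (A : set (measurableTypeR R)) : measurable A ->
  mu (iter m (fmap_geo p) @^-1` A) = mu A.
Proof.
move=> mA; elim: m => [//|m IH].
rewrite -IH -[RHS]mu_inv; last first.
  by rewrite -[X in measurable X]setTI; exact: measurable_iter_fmap_geo.
by congr (mu _); apply/seteqP; split => x; rewrite /preimage /= -iterSr.
Qed.

Lemma mu_ball0_le : exists2 M : R, 0 <= M &
  forall c : R, 0 < c -> (mu `](- c)%R, c[%classic <= (M * c)%:E)%E.
Proof.
have [g [M [mg gM dens]]] := mu_dens.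
have M0 : 0 <= M by case/andP: (gM 0) => h1 h2; exact: le_trans h2.
exists (M * 2); first by rewrite mulr_ge0.
move=> c c0; rewrite dens//; set D : set (measurableTypeR R) := `](- c), c[%classic.
apply: (@le_trans _ _ (\int[lebesgue_measure]_(x in D) (cst M%:E x))%E).
  apply: ge0_le_integral => //=.
  - exact: measurable_itv.
  - by move=> x _; rewrite lee_fin; case/andP: (gM x).
  - by apply/measurable_EFinP; apply: measurable_funTS.
  - by move=> x _; rewrite lee_fin; case/andP: (gM x).
rewrite integral_cst; last exact: measurable_itv.
have lD : lebesgue_measure (`](- c), c[%classic : set R) = (c + c)%:E.
  by rewrite lebesgue_measure_itv/= lte_fin gtrN// -EFinD opprK.
rewrite [X in (_ * X)%E](_ : _ = (c + c)%:E); last exact: lD.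
by rewrite -EFinM lee_fin; lra.
Qed.

(** The orbit segment up to time [n] violates slow approach at time [m]. *)
Definition close_visit (b : R) n m : set (measurableTypeR R) :=
  iter m (fmap_geo p) @^-1` `](- (b * (9 / 10) ^+ (n - m))), (b * (9 / 10) ^+ (n - m))[%classic.

Definition fast_approach (b : R) n : set (measurableTypeR R) :=
  \bigcup_(m in `I_n.+1) close_visit b n m.

Lemma fast_approachP b n x : ~ fast_approach b n x -> slow_approach p b n x.
Proof.
move=> H m mn; rewrite leNgt; apply/negP => lt; apply: H.
by exists m => //=; rewrite /close_visit /= in_itv/= -ltr_norml.
Qed.

Lemma measurable_preimage_iter m (A : set (measurableTypeR R)) : measurable A ->
  measurable (iter m (fmap_geo p) @^-1` A : set (measurableTypeR R)).
Proof.
by move=> mA; rewrite -[X in measurable X]setTI; exact: measurable_iter_fmap_geo.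
Qed.

Lemma measurable_fast_approach b n : measurable (fast_approach b n).
Proof.
rewrite /fast_approach bigcup_mkord.
by apply: bigsetU_measurable => m _; exact: measurable_preimage_iter.
Qed.

(** By invariance and the bounded density a close visit at time [m] has measure of
    order [b * (9/10)^(n - m)]; the sum over [m] is bounded uniformly in [n]. *)
Lemma mu_fast_approach_le : exists2 M : R, 0 <= M &
  forall (b : R) n, 0 < b -> (mu (fast_approach b n) <= (M * b)%:E)%E.
Proof.
have [M M0 HM] := mu_ball0_le; exists (M * 10); first by rewrite mulr_ge0.
move=> b n b0.
rewrite /fast_approach bigcup_mkord.
have sub := @le_mu_bigsetU _ _ _ mu (close_visit b n) n.+1.
apply: (le_trans (sub _)).
  by move=> m _; exact: measurable_preimage_iter.
apply: (@le_trans _ _ (\sum_(m < n.+1) (M * (b * (9 / 10) ^+ (n - m)))%:E)%E).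
  apply: lee_sum => m _; set c := b * (9 / 10) ^+ (n - m).
  have c0 : 0 < c by rewrite /c mulr_gt0// exprn_gt0//; lra.
  have := HM c c0; rewrite -(mu_iter_fmap_geo m); first exact.
  exact: measurable_itv.
rewrite sumEFin lee_fin -mulr_sumr -mulr_sumr -mulrA ler_wpM2l// mulrC ler_wpM2r ?(ltW b0)//.
have := @geometric_sum_le R (9 / 10) n; rewrite big_mkord => h.
have E : (1 - 9 / 10)^-1 = 10 :> R by field.
by rewrite -[leRHS]E; apply: h; lra.
Qed.

Definition eventually_fast (b : R) : set (measurableTypeR R) :=
  \bigcup_N \bigcap_(n in [set n | (N <= n)%N]) fast_approach b n.

Lemma measurable_eventually_fast b : measurable (eventually_fast b).
Proof.
apply: bigcup_measurable => N _; apply: bigcap_measurable => [|n _].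
  by exists N => /=.
exact: measurable_fast_approach.
Qed.

Lemma mu_eventually_fast_le : exists2 M : R, 0 <= M &
  forall b : R, 0 < b -> (mu (eventually_fast b) <= (M * b)%:E)%E.
Proof.
have [M M0 HM] := mu_fast_approach_le; exists M => // b b0.
set F := fun N => \bigcap_(n in [set n | (N <= n)%N]) fast_approach b n.
have mF N : measurable (F N).
  apply: bigcap_measurable => [|n _]; first by exists N => /=.
  exact: measurable_fast_approach.
have homoF : {homo F : n m / (n <= m)%N >-> (n <= m)%O}.
  move=> n m nm; apply/subsetPset => x Fx i /= mi; apply: Fx => /=.
  exact: leq_trans mi.
have cv := nondecreasing_cvg_mu (mu := mu) mF (measurable_eventually_fast b) homoF.
rewrite -(cvg_lim _ cv)//; apply: lime_le; first by apply/cvg_ex; eexists; exact: cv.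
near=> N => /=; apply: le_trans (HM b N b0).
by apply: le_measure; rewrite ?inE//; [exact: measurable_fast_approach|move=> x; apply => /=].
Unshelve. all: by end_near. Qed.

(** The measures of the events of fast approach do not tend to [0] with [n], but
    they are bounded by a multiple of [b]; so is the measure of the points for
    which these events occur at all late times.  Letting [b] tend to [0], almost
    every point escapes them infinitely often for some [b].  The boundary points
    [1/2] and [-1/2] are removed because there the inverse image of an interval
    of increments may leave [[-1/2, 1/2]]. *)
Lemma ae_infinitely_often_slow : mu `<< lebesgue_measure ->
  {ae mu, forall x, `|x| <= 1 / 2 -> `|x| < 1 / 2 /\
    exists2 b : R, 0 < b & forall N, exists2 n, (N <= n)%N & slow_approach p b n x}.
Proof.
move=> /null_content_dominatesP ac.
have [M M0 HM] := mu_eventually_fast_le.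
have E0 : mu (\bigcap_i eventually_fast i.+1%:R^-1) = 0%E.
  apply/eqP; rewrite eq_le measure_ge0 andbT; apply/lee_addgt0Pr => e e0; rewrite add0e.
  have [i iE] : exists i : nat, M / e < i.+1%:R.
    by exists (Num.truncn (M / e)); exact: truncnS_gt.
  apply: (@le_trans _ _ (mu (eventually_fast i.+1%:R^-1))).
    apply: le_measure; rewrite ?inE//; last by move=> x; exact.
      by apply: bigcap_measurable => // j _; exact: measurable_eventually_fast.
    exact: measurable_eventually_fast.
  apply: le_trans (HM _ _) _; first by rewrite invr_gt0.
  rewrite lee_fin ler_pdivrMr ?ltr0n//.
  by move: iE; rewrite ltr_pdivrMr// => /ltW; rewrite mulrC.
pose X : set (measurableTypeR R) :=
  (\bigcap_i eventually_fast i.+1%:R^-1) `|` ([set 1 / 2] `|` [set - (1 / 2)]).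
have null1 (c : R) : mu.-negligible [set c].
  exists [set c]; split => //; apply: ac; first exact: measurable_set1.
  exact: lebesgue_measure_set1.
suff : mu.-negligible X.
  apply: negligibleS => x /=; apply: contra_notP => /not_orP[nE /not_orP[n1 n2]] x1.
  split.
    rewrite lt_neqAle x1 andbT; apply/negP => /eqP xE.
    have [x0|x0] := leP 0 x.
      by apply: n1; rewrite /= -xE ger0_norm.
    by apply: n2; rewrite /= -xE ltr0_norm// opprK.
  have [i] : exists i : nat, ~ eventually_fast i.+1%:R^-1 x.
    by apply/existsNP => H; apply: nE => i _; exact: H.
  move=> nEi; exists i.+1%:R^-1; first by rewrite invr_gt0.
  move=> N; apply: contrapT => H; apply: nEi; exists N => // n /= Nn.
  apply: contrapT => nf; apply: H; exists n => //; exact: fast_approachP.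
apply: negligibleU; last by apply: negligibleU; exact: null1.
exists (\bigcap_i eventually_fast i.+1%:R^-1); split => //.
by apply: bigcap_measurable => // j _; exact: measurable_eventually_fast.
Qed.

End recurrence.

(** * The expected diameter of the support of the filter *)

(** The integral of a nonnegative function is the supremum of the integrals of
    the simple functions below it.  This gives a lower bound for the expected
    diameter of a random set, a function whose measurability is unclear. *)
Lemma integral_ge_indic (d : measure_display) (T : measurableType d) (R : realType)
    (mu : {measure set T -> \bar R}) (f : T -> \bar R) (B : set T) (c : R) :
  0 <= c -> measurable B -> (forall x, 0 <= f x)%E ->
  (forall x, B x -> (c%:E <= f x)%E) -> (c%:E * mu B <= \int[mu]_x f x)%E.
Proof.
move=> c0 mB f0 cf; rewrite ge0_integralTE//.
apply: ereal_sup_ubound => /=.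
exists (scale_nnsfun (indic_nnsfun R mB) c0) => [x /=|].
  rewrite mindicE; case: (boolP (x \in B)) => xB.
    by rewrite mulr1; apply: cf; rewrite inE in xB.
  by rewrite mulr0.
have := @sintegralrM _ T R mu c (indic_nnsfun R mB).
by rewrite sintegral_indic.
Qed.

Lemma le_mu_bigsetU_seq (d : measure_display) (T : measurableType d) (R : realType)
    (mu : {measure set T -> \bar R}) (I : Type) (s : seq I) (A : I -> set T) :
  (forall i, measurable (A i)) ->
  (mu (\big[setU/set0]_(i <- s) A i) <= \sum_(i <- s) mu (A i))%E.
Proof.
move=> mA; elim: s => [|i s IH]; first by rewrite !big_nil measure0.
rewrite !big_cons.
have mU : measurable (\big[setU/set0]_(j <- s) A j) by exact: bigsetU_measurable.
have := measureU2 mu (mA i) mU.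
by move/le_trans; apply; exact: leeD2l.
Qed.

Lemma has_ubound_opnorm (R : realType) (m n : nat) (H : 'M[R]_(m, n)) :
  has_ubound [set `|H *m x| | x in [set x : 'cV[R]_n | `|x| <= 1]].
Proof.
exists (n%:R * `|H|) => y [x /= x1 <-].
apply: mx_norm_leP => [|i j]; first by rewrite mulr_ge0.
rewrite mxE; apply: le_trans (ler_norm_sum _ _ _) _.
apply: (@le_trans _ _ (\sum_(k < n) `|H|)); last by rewrite sumr_const card_ord mulr_natl.
apply: ler_sum => k _; rewrite normrM -[leRHS]mulr1.
by apply: ler_pM; rewrite ?coord_le_norm// (le_trans (coord_le_norm _ _ _)).
Qed.

Lemma mulmx_le_opnorm (R : realType) (m n : nat) (H : 'M[R]_(m, n.+1)) (x : 'cV[R]_n.+1) :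
  `|H *m x| <= opnorm H * `|x|.
Proof.
have [->|x0] := eqVneq x 0; first by rewrite mulmx0 !normr0 mulr0.
have xp : 0 < `|x| by rewrite normr_gt0.
rewrite -ler_pdivrMr//; apply: (ub_le_sup (has_ubound_opnorm H)).
exists (`|x|^-1 *: x) => /=.
  by rewrite normrZ ger0_norm ?invr_ge0// mulVf ?gt_eqF.
by rewrite -scalemxAr normrZ (@ger0_norm _ `|x|^-1) ?invr_ge0// mulrC.
Qed.

(** Two intervals of length [2 * eps] whose centers are at distance [|c|] overlap
    in an interval of length [2 * eps - |c|]. *)
Lemma uniform_prob_shift_ge (R : realType) (eps c : R) (eps_gt0 : 0 < eps) :
  exists I : set (measurableTypeR R), [/\ measurable I,
      (forall z, I z -> `|z| <= eps /\ `|z - c| <= eps) &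
    ((1 - `|c| / (2 * eps))%:E <= uniform_prob (gtrN eps_gt0) I)%E].
Proof.
have [big|small] := leP (2 * eps) `|c|.
  exists set0; split => //.
  rewrite measure0 lee_fin subr_le0 ler_pdivlMr; lra.
set l := if 0 <= c then c - eps else - eps; set r := if 0 <= c then eps else c + eps.
have lr : r - l = 2 * eps - `|c|.
  rewrite /r /l; case: ifPn => [c0|]; first by rewrite ger0_norm//; ring.
  by rewrite -ltNge => c0; rewrite ltr0_norm//; ring.
have lr0 : l < r by lra.
have lI : - eps <= l /\ r <= eps.
  by rewrite /l /r; case: ifPn => [c0|]; [lra|rewrite -ltNge => c0; lra].
pose J : set R := `[l, r]%classic.
exists (J : set (measurableTypeR R)); split; first exact: measurable_itv.
  move=> z; rewrite /J /= in_itv/= /l /r !ler_norml.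
  by case: ifPn => [c0|]; [lra|rewrite -ltNge => c0; lra].
rewrite /uniform_prob.
have lJ : lebesgue_measure J = (r - l)%:E.
  by rewrite /J lebesgue_measure_itv/= lte_fin lr0 -EFinD.
have -> : (\int[lebesgue_measure]_(x in J) (uniform_pdf (- eps) eps x)%:E =
          \int[lebesgue_measure]_(x in J) cst ((eps - - eps)^-1)%:E x)%E.
  apply: eq_integral => x; rewrite inE /J /= in_itv/= => /andP[x1 x2].
  rewrite /uniform_pdf; case: ifPn => // /negP[].
  by apply/andP; split; lra.
rewrite integral_cst; last exact: measurable_itv.
rewrite [X in (_ * X)%E](_ : _ = (r - l)%:E); last exact: lJ.
rewrite -EFinM lee_fin lr le_eqVlt; apply/orP; left; apply/eqP.
by field; rewrite !gt_eqF//; lra.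
Qed.

Section filter.
Context (R : realType) (p : lorenz_params R).
Context (dO : nat) (H : 'M[R]_(dO, 3)) (eps : R) (eps_gt0 : 0 < eps).
Context (dsp : measure_display) (Omega : measurableType dsp) (P : probability Omega R)
  (Z : nat -> {RV P >-> dO.-tuple (measurableTypeR R)})
  (uZ : forall i, uniform_on_cube eps_gt0 (Z i)).

Lemma noise_coordinate_prob i (a : 'I_dO) (I : set (measurableTypeR R)) :
  measurable I ->
  measurable (Z i @^-1` [set y | I (tnth y a)]) /\
  P (Z i @^-1` [set y | I (tnth y a)]) = uniform_prob (gtrN eps_gt0) I.
Proof.
move=> mI; split.
  rewrite -[X in measurable X]setTI.
  apply: (measurable_funP (Z i)) => //.
  rewrite -[X in measurable X]setTI.
  exact: (measurable_tnth a).
have := uZ i (A := fun a' => if a' == a then I else setT).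
rewrite (bigD1 a)//= eqxx big1 ?mule1; last first.
  by move=> a' /negbTE ->; exact: probability_setT.
move=> <-; last by move=> a'; case: ifP.
rewrite /distribution /pushforward; congr (P _); apply/seteqP; split => w /=.
  by move=> Iw a'; case: eqP => [->|].
by move=> /(_ a); rewrite eqxx.
Qed.

(** The noise keeps a competing trajectory consistent with all observations
    with probability at least [1/2], by a union bound over the times and the
    coordinates of the observations. *)
Lemma consistent_noise (k : nat) (D : nat -> 'cV[R]_3) (S : R) :
  \sum_(0 <= i < k.+1) `|D i| <= S -> dO%:R * opnorm H * S <= eps ->
  exists B : set Omega, [/\ measurable B, ((1 / 2)%:E <= P B)%E &
    forall w, B w -> forall i, (i <= k)%N -> forall a : 'I_dO,
      `|tnth (Z i w) a| <= eps /\ `|tnth (Z i w) a - (H *m D i) a 0| <= eps].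
Proof.
move=> DS Se.
have Ex (ia : nat * 'I_dO) := uniform_prob_shift_ge ((H *m D ia.1) ia.2 0) eps_gt0.
have [I HI] := choice Ex.
pose G (ia : nat * 'I_dO) : set Omega := Z ia.1 @^-1` [set y | I ia (tnth y ia.2)].
have mG ia : measurable (G ia).
  by have [mI _ _] := HI ia; have [] := noise_coordinate_prob ia.1 ia.2 mI.
pose s := [seq (i, a) | i <- index_iota 0 k.+1, a <- enum 'I_dO].
pose N := \big[setU/set0]_(ia <- s) ~` G ia.
have mN : measurable N by apply: bigsetU_measurable => ia _; exact: measurableC.
exists (~` N); split; first exact: measurableC.
  rewrite probability_setC// -[X in (X <= _)%E](_ : 1 - (1 / 2)%:E = _)%E; last first.
    by rewrite -EFinB; congr EFin; field.
  apply: leeB => //; apply: le_trans (le_mu_bigsetU_seq _ _ _) _.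
    by move=> ia; exact: measurableC.
  apply: (@le_trans _ _ (\sum_(ia <- s) (`|(H *m D ia.1) ia.2 0| / (2 * eps))%:E)%E).
    apply: lee_sum => ia _; have [mI _ pI] := HI ia.
    apply: (@le_trans _ _ (P (~` G ia))); first exact: lexx.
    rewrite probability_setC//; have [_ ->] := noise_coordinate_prob ia.1 ia.2 mI.
    by apply: le_trans (leeB (lexx _) pI) _; rewrite -EFinB lee_fin; lra.
  rewrite sumEFin lee_fin -mulr_suml ler_pdivrMr; last by rewrite mulr_gt0.
  rewrite [leRHS](_ : _ = eps); last by field.
  apply: le_trans Se.
  rewrite /s big_allpairs_dep/=.
  apply: (@le_trans _ _ (\sum_(0 <= i < k.+1) dO%:R * opnorm H * `|D i|)).
    apply: ler_sum => i _.
    apply: (@le_trans _ _ (\sum_(a <- enum 'I_dO) opnorm H * `|D i|)).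
      by apply: ler_sum => a _; apply: le_trans (coord_le_norm _ _ _) (mulmx_le_opnorm _ _).
    by rewrite big_enum/= sumr_const card_ord -mulrA mulr_natl.
  rewrite -mulr_sumr ler_wpM2l// mulr_ge0//.
  apply: le_trans (ub_le_sup (has_ubound_opnorm H) (x := 0) _) => //.
  by exists 0; rewrite /= ?normr0// mulmx0 normr0.
move=> w Nw i ik a.
have [_ h _] := HI (i, a); apply: h.
apply: contrapT => nI; apply: Nw; rewrite /N -bigcup_seq; exists (i, a) => //=.
by apply: allpairs_f; rewrite ?mem_index_iota ?mem_enum.
Qed.

Lemma diam_ge0 (A : set 'cV[R]_3) : (0 <= diam A)%E.
Proof. by apply: ereal_sup_ubound; left. Qed.

Lemma diam_ge (A : set 'cV[R]_3) v w : A v -> A w -> (`|v - w|%:E <= diam A)%E.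
Proof. by move=> Av Aw; apply: ereal_sup_ubound; right; exists v => //; exists w. Qed.

(** With probability at least [1/2] both the true trajectory and the competing
    one are consistent with the observations. *)
Lemma expected_diam_ge (h S : R) (q : 'cV[R]_3 -> R) (k : nat) (u v : 'cV[R]_3) :
  Lambda_geo p u -> Lambda_geo p v -> (forall w, Lambda_geo p w -> 0 < q w) ->
  \sum_(0 <= i < k.+1) `|Psi_geo p (i%:R * h) v - Psi_geo p (i%:R * h) u| <= S ->
  dO%:R * opnorm H * S <= eps ->
  ((`|Psi_geo p (k%:R * h) v - Psi_geo p (k%:R * h) u| / 2)%:E <=
   \int[P]_w diam (filter_support p h H q eps
              (observation p h H u (fun i => Z i w)) k))%E.
Proof.
move=> uL vL q0 sumS Se.
have [B [mB PB HB]] := consistent_noise sumS Se.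
set d := `|Psi_geo p (k%:R * h) v - _|.
have d0 : 0 <= d by exact: normr_ge0.
apply: (@le_trans _ _ (d%:E * P B)%E).
  rewrite EFinM; apply: lee_wpmul2l; first by rewrite lee_fin /d.
  by apply: le_trans PB; rewrite lee_fin; lra.
apply: integral_ge_indic => // [w|w Bw]; first exact: diam_ge0.
apply: diam_ge.
  exists v => //; split => //; first exact: q0.
  move=> i ik; apply: mx_norm_leP; first exact: ltW.
  move=> a j; rewrite ord1; have [_] := HB w Bw i ik a.
  by rewrite /observation mulmxBr !mxE; congr (`|_| <= _); ring.
exists u => //; split => //; first exact: q0.
move=> i ik; apply: mx_norm_leP; first exact: ltW.
move=> a j; rewrite ord1; have [+ _] := HB w Bw i ik a.
by rewrite /observation addrAC subrr add0r mxE.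
Qed.

End filter.

(** * Assembling the curves *)

Lemma increasing_selection (P : nat -> Prop) :
  (forall K, exists2 k, (K <= k)%N & P k) ->
  exists2 idx : nat -> nat, {homo idx : m n / (m < n)%N} & forall j, P (idx j).
Proof.
move=> H; have ex K : exists k, (K <= k)%N /\ P k by have [k] := H K; exists k.
have [f Hf] := choice ex.
pose idx := fix idx j := if j is j'.+1 then f (idx j').+1 else f 0%N.
exists idx; last by case=> [|j]; exact: (Hf _).2.
by apply: homo_ltn => [|j]; [exact: ltn_trans|exact: (Hf _).1].
Qed.

Lemma slow_approach_nonzero (R : realType) (p : lorenz_params R) (b : R) n (o : 'cV[R]_3) :
  admissible p -> 0 < b -> slow_approach p b n (o 0 0) -> nonzero_upto p n.+1 o.
Proof.
move=> p_adm b0 sl i; rewrite ltnS => /sl; rewrite section_orbit_fmap// -normr_gt0.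
by apply: lt_le_trans; rewrite mulr_gt0// exprn_gt0//; lra.
Qed.

(** Observation times shortly after the end of an orbit segment that approaches
    the discontinuity slowly occur arbitrarily late. *)
Lemma late_observation_times (R : realType) (p : lorenz_params R) (p_adm : admissible p)
    (o : 'cV[R]_3) (a h b : R) (N0 : nat) :
  section_S o -> 0 < h -> 0 < b ->
  (forall N, exists2 n, (N <= n)%N & slow_approach p b n (o 0 0)) ->
  forall K, exists2 k, (K <= k)%N & exists n, [/\ (N0 <= n)%N, slow_approach p b n (o 0 0) &
    nth_return_time p n o + h <= a + k%:R * h <= nth_return_time p n o + 2 * h].
Proof.
move=> oS h0 b0 io K.
(* [T_n >= n], so this choice of [n] gives [T_n >= a + K * h]. *)
have [n nN sl] := io (maxn N0 (Num.truncn (`|a| + K%:R * h)).+1).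
move: nN; rewrite geq_max => /andP[nN0 nK].
have Tn : n%:R <= nth_return_time p n o.
  apply: nth_return_time_ge => //.
  exact: nonzero_upto_le (leqnSn n) (slow_approach_nonzero p_adm b0 sl).
have nb : `|a| + K%:R * h < n%:R.
  by apply: lt_le_trans (truncnS_gt _) _; rewrite ler_nat.
have Kh : 0 <= K%:R * h by rewrite mulr_ge0// ltW.
have aa := ler_norm a.
set T := nth_return_time p n o in Tn *.
set z := (T + h - a) / h.
have z0 : 0 <= z by rewrite divr_ge0 ?(ltW h0)//; lra.
have zh : z * h = T + h - a by rewrite divfK ?gt_eqF.
have zlt := truncnS_gt z.
have zge : (Num.truncn z)%:R <= z by rewrite truncn_le.
exists (Num.truncn z).+1; last first.
  exists n; split => //.
  have h1 : z * h <= (Num.truncn z).+1%:R * h by rewrite ler_wpM2r ?(ltW h0)// ltW.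
  have h2 : (Num.truncn z).+1%:R * h <= (z + 1) * h.
    by rewrite ler_wpM2r ?(ltW h0)// -natr1; lra.
  move: h1 h2; rewrite [(z + 1) * h]mulrDl mul1r zh => h1 h2.
  by rewrite -/T; apply/andP; split; lra.
rewrite -(ler_nat R); apply: ltW; apply: le_lt_trans zlt.
by rewrite -(ler_pM2r h0) zh; lra.
Qed.

Theorem theorem2p4 (R : realType) (p : lorenz_params R) (p_adm : admissible p)
    (mu : probability (measurableTypeR R) R) (mu_f : is_mu_f p mu) :
  exists2 h_max : R, 0 < h_max &
  forall h : R, 0 < h <= h_max ->
  {ae mu, forall x, `|x| <= 1 / 2 ->
    forall u : 'cV[R]_3, Lambda_geo p u -> origin p u 0 0 = x ->
    exists (U : nat -> set 'cV[R]_3) (dmax C : nat -> R) (idx : nat -> nat)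
           (dmax_u C_u : R),
    [/\ [/\ forall k, continuous_curve (U k) /\ U k `<=` Lambda_geo p,
            forall k, 0 <= dmax k,
            {homo idx : m n / (m < n)%N}
          & 0 < dmax_u],
        forall k,
          [set `|Psi_geo p (k%:R * h) v - Psi_geo p (k%:R * h) u| | v in U k]
          = `[0, dmax k]%classic,
        forall k v, U k v ->
          \sum_(0 <= i < k.+1)
             `|Psi_geo p (i%:R * h) v - Psi_geo p (i%:R * h) u|
          <= C k * `|Psi_geo p (k%:R * h) v - Psi_geo p (k%:R * h) u|,
        forall j, C (idx j) <= C_u /\ dmax_u <= dmax (idx j)
      & forall (dO : nat) (H : 'M[R]_(dO, 3)) (q : 'cV[R]_3 -> R),
          is_prior_density p q -> (forall v, Lambda_geo p v -> 0 < q v) ->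
        forall (j : nat) (eps : R) (eps_gt0 : 0 < eps),
          eps <= dO%:R * C_u * dmax_u * opnorm H ->
        forall (dsp : measure_display) (Omega : measurableType dsp)
               (P : probability Omega R)
               (Z : nat -> {RV P >-> dO.-tuple (measurableTypeR R)}),
          independent_RVs Z -> (forall i, uniform_on_cube eps_gt0 (Z i)) ->
          ((eps / (2 * dO%:R * C_u * opnorm H))%:E <=
           \int[P]_w diam (filter_support p h H q eps
              (observation p h H u (fun i => Z i w)) (idx j)))%E]}.
Proof.
have [[_ mu_inv mu_ac] _ _ mu_dens] := mu_f.
have l1 := lam1_gt0 p_adm.
exists (ln 2 / (3 * lam1 p)); first by rewrite divr_gt0 ?ln_gt0 ?mulr_gt0//; lra.
move=> h /andP[h0 hmax].
have hT : lam1 p * (3 * h) <= ln 2.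
  by move: hmax; rewrite ler_pdivlMr ?mulr_gt0//; lra.
have ae := ae_infinitely_often_slow mu_inv mu_dens mu_ac.
apply: negligibleS ae => x; apply: contra_not => good x1 u uL ux; subst x.
have {good x1} [x1 [b b0 io]] := good x1.
have [oS /andP[a0 ba] _] := originP uL.
have x0 : origin p u 0 0 != 0.
  by have [n _ sl] := io 0%N; have /(_ 0%N isT) := slow_approach_nonzero p_adm b0 sl.
have ba' : 0 < (return_time p (origin p u) - age p u) / 2 * (lam1 p * (b / 2)).
  rewrite mulr_gt0 ?mulr_gt0 ?divr_gt0 ?subr_gt0//.
  by move: ba; rewrite (negbTE x0).
have [N1 HN1] : exists N, forall n, (N <= n)%N -> (3 / 4) ^+ n <= 1 / 2 - `|origin p u 0 0|.
  by apply: expr_eventually_le; lra.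
have [N2 HN2] : exists N, forall n, (N <= n)%N -> (5 / 6) ^+ n <=
    (return_time p (origin p u) - age p u) / 2 * (lam1 p * (b / 2)).
  by apply: expr_eventually_le => //; lra.
set C_u := sum_const p (b / 2) h * separation_const p (3 * h).
set dmax_u := curve_size p h b / separation_const p (3 * h).
have dmax_u0 : 0 < dmax_u.
  rewrite divr_gt0//; last exact: separation_const_gt0.
  by have [] := curve_size_bounds p_adm h0 b0.
have late := late_observation_times p_adm (age p u) (maxn N1 N2) oS h0 b0 io.
have [idx idx_incr idxP] := increasing_selection late.
(* At the other times the curve is the single point [u]. *)
pose spec k (UM : set 'cV[R]_3 * R) := [/\ continuous_curve UM.1 /\ UM.1 `<=` Lambda_geo p,
  0 <= UM.2,
  [set `|Psi_geo p (k%:R * h) v - Psi_geo p (k%:R * h) u| | v in UM.1] = `[0, UM.2]%classic,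
  (forall v, UM.1 v -> \sum_(0 <= i < k.+1)
       `|Psi_geo p (i%:R * h) v - Psi_geo p (i%:R * h) u|
     <= C_u * `|Psi_geo p (k%:R * h) v - Psi_geo p (k%:R * h) u|)
  & (exists j, idx j = k) -> dmax_u <= UM.2].
have ex_curve k : exists UM, spec k UM.
  have [[j jk]|nidx] := pselect (exists j, idx j = k).
    have [n [nN sl ak]] := idxP j; rewrite jk in ak.
    move: nN; rewrite geq_max => /andP[nN1 nN2].
    have [U [M [cU UL dM imU sumU]]] :=
      unstable_curve_at p_adm uL h0 hT b0 x0 x1 sl (HN1 n nN1) (HN2 n nN2) ak.
    by exists (U, M); split => //=; apply: le_trans dM; exact: ltW.
  exists ([set u], 0); split => //=.
  - split; last by move=> _ ->.
    exists (fun=> u); first by apply: continuous_subspaceT; exact: cst_continuous.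
    apply/seteqP; split => [_ ->|_ [t _ <-]//].
    by exists 0; rewrite //= in_itv/= lexx ler01.
  - apply/seteqP; split => [_ [_ -> <-]|y].
      by rewrite subrr normr0 /= in_itv/= lexx.
    rewrite /= in_itv/= -eq_le => /eqP <-; exists u => //.
    by rewrite subrr normr0.
  - move=> _ ->; rewrite subrr normr0 mulr0 big1// => i _.
    by rewrite subrr normr0.
have [UM HUM] := choice ex_curve.
exists (fun k => (UM k).1), (fun k => (UM k).2), (fun=> C_u), idx, dmax_u, C_u.
split.
- split => // k; first by have [] := HUM k.
  by have [] := HUM k.
- by move=> k; have [] := HUM k.
- by move=> k v; have [_ _ _ + _] := HUM k; apply.
- by move=> j; split => //; have [_ _ _ _] := HUM (idx j); apply; exists j.
move=> dO H q _ q0 j eps eps0 epsle dsp Omega P Z _ uZ.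
have [[_ UL] M0 imU sumU dM] := HUM (idx j).
have {}dM := dM (ex_intro _ j erefl).
have W0 : 0 < dO%:R * C_u * opnorm H.
  have : 0 < dmax_u * (dO%:R * C_u * opnorm H).
    by apply: (lt_le_trans eps0); apply: le_trans epsle _; rewrite le_eqVlt; apply/orP; left;
      apply/eqP; ring.
  by rewrite pmulr_rgt0.
(* The distance for which the union bound gives probability [1/2]. *)
set d := eps / (dO%:R * C_u * opnorm H).
have : (`[0, (UM (idx j)).2]%classic : set R) d.
  rewrite /= in_itv/= divr_ge0 ?(ltW eps0) ?(ltW W0)//=.
  apply: le_trans dM; rewrite ler_pdivrMr//.
  by apply: le_trans epsle _; rewrite le_eqVlt; apply/orP; left; apply/eqP; ring.
rewrite -imU => -[v Uv dE].
have := sumU v Uv; rewrite dE => sumv.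
have Wn : dO%:R != 0 :> R /\ C_u != 0 /\ opnorm H != 0.
  by move: (W0) => /lt0r_neq0; rewrite !mulf_eq0 !negb_or => /andP[/andP[-> ->] ->].
have [dO0 [C0 op0]] := Wn.
have := expected_diam_ge uZ uL (UL v Uv) q0 sumv.
rewrite dE; have -> : d / 2 = eps / (2 * dO%:R * C_u * opnorm H).
  by rewrite /d; field; rewrite dO0 C0 op0.
apply; rewrite /d le_eqVlt; apply/orP; left; apply/eqP; field.
by rewrite dO0 C0 op0.
Qed.
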